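(* Pullbacks exist in the category $\mathrm{GrGp}^*$ of connected pointed graphs of groups (with morphisms up to $\sim$-equivalence). More precisely, if $\mu^B\colon(\mathbb B,v_0)\to(\mathbb A,u_0)$ and $\mu^C\colon(\mathbb C,w_0)\to(\mathbb A,u_0)$ are morphisms between connected pointed graphs of groups, then their pointed $\mathbb A$-product (the connected component, containing the basepoint $x_0$, of $\mathbb B\,\widetilde\times_{\mathbb A}\,\mathbb C$, with basepoint $x_0$), together with the projection morphisms $\rho^B$ and $\rho^C$, is the pullback of $\mu^B$ and $\mu^C$ in $\mathrm{GrGp}^*$.
   Context: **Conventions.** For group elements, $x^g=g^{-1}xg$ and $\gamma_g(x)=x^g$. A graph $\mathsf A$ has a vertex set $V(\mathsf A)$, an edge set $E(\mathsf A)$, maps $o,t\colon E(\mathsf A)\to V(\mathsf A)$ and a fixed-point-free involution $e\mapsto e^{-1}$ on edges with $t(e^{-1})=o(e)$; graph morphisms preserve this structure. **Graphs of groups.** A graph of groups $\mathbb A$ consists of a graph $\mathsf A$, vertex groups $A_u$, edge groups $A_e=A_{e^{-1}}$, and monomorphisms $\alpha_e\colon A_e\to A_{o(e)}$, $\omega_e\colon A_e\to A_{t(e)}$ with $\omega_e=\alpha_{e^{-1}}$. It is connected if $\mathsf A$ is. A pointed graph of groups $(\mathbb A,u_0)$ has a distinguished vertex $u_0$. **Morphisms.** A morphism $\mu\colon\mathbb B\to\mathbb A$ consists of a graph morphism $\mathsf B\to\mathsf A$ (also written $\mu$), monomorphisms $\mu_v\colon B_v\to A_{\mu(v)}$ and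 $\mu_f\colon B_f\to A_{\mu(f)}$, and, for each edge $f$ of $\mathsf B$, twisting elements $f_\alpha\in A_{\mu(o(f))}$, $f_\omega\in A_{\mu(t(f))}$ with $(f^{-1})_\alpha=f_\omega$ and $(f^{-1})_\omega=f_\alpha$, such that with $e=\mu(f)$, $v=o(f)$, $v'=t(f)$: $\alpha_e\circ\mu_f=\gamma_{f_\alpha}\circ\mu_v\circ\alpha_f$ and $\omega_e\circ\mu_f=\gamma_{f_\omega}\circ\mu_{v'}\circ\omega_f$. (We often omit subscripts on $\mu$.) It is pointed if it maps basepoint to basepoint. Morphisms $\mu\colon\mathbb C\to\mathbb B$, $\nu\colon\mathbb B\to\mathbb A$ compose in the obvious way, the $\alpha$-twisting element of an edge $g$ under $\nu\circ\mu$ being $\nu(g_\alpha)\,\mu(g)_\alpha$. **Equivalence.** Two morphisms $\mu^1,\mu^2\colon\mathbb B\to\mathbb A$ are $\approx$-equivalent if they agree on the underlying graph and there are elements $a_v\in A_{\mu^1(v)}$ ($v\in V(\mathsf B)$) and $a_f\in A_{\mu^1(f)}$ ($f\in E(\mathsf B)$) with $a_{f^{-1}}=a_f$, $\mu^2_v=\gamma_{a_v}\circ\mu^1_v$, and $a_v=f^1_\alpha\,\alpha_{\mu^1(f)}(a_f)\,(f^2_\alpha)^{-1}$ whenever $o(f)=v$, where $f^i_\alpha$ is the twisting element for $\mu^i$. If the morphisms are pointed, from connected $(\mathbb B,v_0)$, they are $\sim$-equivalent if moreover one can take $a_{v_0}=1$. The category $\mathrm{GrGp}^*$ has as objects the connected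 pointed graphs of groups and as arrows the $\sim$-classes of pointed morphisms. **Pullback.** In a category, the pullback of $\mu^B\colon B\to A$ and $\mu^C\colon C\to A$ is an object $P$ with arrows $\rho^B\colon P\to B$, $\rho^C\colon P\to C$ such that $\mu^B\rho^B=\mu^C\rho^C$ and, for all $\sigma^B\colon P'\to B$, $\sigma^C\colon P'\to C$ with $\mu^B\sigma^B=\mu^C\sigma^C$, there is a unique $\sigma\colon P'\to P$ with $\rho^B\sigma=\sigma^B$, $\rho^C\sigma=\sigma^C$. **The $\mathbb A$-product.** Given $\mu^B\colon\mathbb B\to\mathbb A$, $\mu^C\colon\mathbb C\to\mathbb A$, the $\mathbb A$-product $\mathbb D=\mathbb B\,\widetilde\times_{\mathbb A}\,\mathbb C$ is defined as follows. For vertices $v,w$ with $\mu^B(v)=\mu^C(w)=u$ let $V_{v,w}$ be the set of double cosets $\mu^B(B_v)\,a\,\mu^C(C_w)$, $a\in A_u$; for edges $f,g$ with $\mu^B(f)=\mu^C(g)=e$ let $E_{f,g}$ be the set of double cosets $\mu^B(B_f)\,a\,\mu^C(C_g)$, $a\in A_e$. Then $V(\mathsf D)=\bigsqcup V_{v,w}$, $E(\mathsf D)=\bigsqcup E_{f,g}$; the inverse of $h\in E_{f,g}$ is the same double coset viewed in $E_{f^{-1},g^{-1}}$; and the edge $\mu^B(B_f)\,a\,\mu^C(C_g)$ has origin $\mu^B(B_{o(f)})\,(f_\alpha\alpha_e(a)g_\alpha^{-1})\,\mu^C(C_{o(g)})$ and terminus $\mu^B(B_{t(f)})\,(f_\omega\omega_e(a)g_\omega^{-1})\,\mu^C(C_{t(g)})$.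 Fix representatives $\tilde x\in x$ and $\tilde h=\widetilde{h^{-1}}\in h$ of the double cosets, and for each $h\in E_{f,g}$ with $o(h)=x\in V_{v,w}$ fix $b_h\in B_v$, $c_h\in C_w$ with $\tilde x=\mu^B(b_h)f_\alpha\alpha_e(\tilde h)g_\alpha^{-1}\mu^C(c_h)^{-1}$. Put $D_x=\{(b,c)\in B_v\times C_w:\tilde x^{-1}\mu^B(b)\tilde x=\mu^C(c)\}$, $D_h=\{(b,c)\in B_f\times C_g:\tilde h^{-1}\mu^B(b)\tilde h=\mu^C(c)\}$, $\alpha_h(b,c)=(b_h\alpha_f(b)b_h^{-1},\,c_h\alpha_g(c)c_h^{-1})$, $\omega_h=\alpha_{h^{-1}}$. The projections $\rho^B\colon\mathbb D\to\mathbb B$, $\rho^C\colon\mathbb D\to\mathbb C$ send $x\in V_{v,w}$ to $v$, $w$ and $h\in E_{f,g}$ to $f$, $g$, are the coordinate projections on vertex and edge groups, and have $\alpha$-twisting elements $b_h$, $c_h$. In the pointed case the basepoint is $x_0=\mu^B(B_{v_0})\mu^C(C_{w_0})\in V_{v_0,w_0}$, with $\tilde x_0=1$. Different choices of representatives give isomorphic results. *)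

(* Defs.v *)
From HB Require Import structures.
From mathcomp Require Import all_boot.
From mathcomp Require Import boolp classical_sets.

Set Implicit Arguments.
Unset Strict Implicit.
Unset Printing Implicit Defensive.

Local Open Scope classical_set_scope.
Local Open Scope group_scope.

Record gmono (G H : groupType) := Mono {
  gmono_fun :> UMagmaMorphism.type G H;
  gmono_inj : injective gmono_fun }.

Arguments gmono_inj {G H} g [x1 x2].

Lemma morph_mul1 (G H : groupType) (f : G -> H) :
  {morph f : x y / x * y} -> f 1 = 1.
Proof. by move=> fM; apply: (mulgI (f 1)); rewrite -fM !mulg1. Qed.

Definition gmono_of (G H : groupType) (f : G -> H)
    (fM : {morph f : x y / x * y}) (fI : injective f) : gmono G H :=
  let m := isUMagmaMorphism.Build G H f (morph_mul1 fM, fM) in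
  let F : UMagmaMorphism.type G H := HB.pack f m in
  @Mono G H F fI.

Lemma gmono_eq (G H : groupType) (f g : gmono G H) : f =1 g -> f = g.
Proof.
case: f g => [[f [[fM] [f1]]] fI] [[g [[gM] [g1]]] gI] /= /funext e.
rewrite /= in e; subst g.
have e1 := Prop_irrelevance fM gM; have e2 := Prop_irrelevance f1 g1.
by subst gM g1; rewrite (Prop_irrelevance fI gI).
Qed.

Definition gmono_id (G : groupType) : gmono G G :=
  @gmono_of G G id (fun _ _ => erefl) (fun _ _ e => e).

Definition gmono_comp (G H K : groupType) (g : gmono H K) (f : gmono G H) :
    gmono G K :=
  @gmono_of G K (g \o f) (comp_gmulfM g f)
    (inj_comp (@gmono_inj _ _ g) (@gmono_inj _ _ f)).

Lemma gmono_compE (G H K : groupType) (g : gmono H K) (f : gmono G H) x :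
  gmono_comp g f x = g (f x).
Proof. by []. Qed.

(* [A_{e^-1} = A_e] and [A_{mu(o(f))} = A_{o(mu(f))}] are only propositional
   equalities, along which elements have to be transported. *)
Definition gcast (G H : groupType) (p : G = H) : gmono G H :=
  match p with erefl => gmono_id G end.

Lemma gcast_id (G : groupType) (p : G = G) x : gcast p x = x.
Proof. by rewrite (Prop_irrelevance p erefl). Qed.

Lemma gcast_comp (G H K : groupType) (p : G = H) (q : H = K) x :
  gcast q (gcast p x) = gcast (etrans p q) x.
Proof. by subst. Qed.

Lemma gcast_irr (G H : groupType) (p q : G = H) x : gcast p x = gcast q x.
Proof. by rewrite (Prop_irrelevance p q). Qed.

(* As t(e^-1) = o(e) and the involution is its own inverse, t is determined by
   o: it is the definition [tgt] below rather than a field. *)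
Record graph := Graph {
  vert : Type;
  edge : Type;
  src : edge -> vert;
  einv : edge -> edge;
  einvK : involutive einv;
  einv_free : forall e, einv e <> e }.

Definition tgt (X : graph) (e : edge X) : vert X := src (einv e).

Lemma tgt_einv (X : graph) (e : edge X) : tgt (einv e) = src e.
Proof. by rewrite /tgt einvK. Qed.

(* Likewise omega_e = alpha_{e^-1} is the definition [omega] below. *)
Record gog := Gog {
  gr :> graph;
  vg : vert gr -> groupType;
  eg : edge gr -> groupType;
  eg_einv : forall e, eg (einv e) = eg e;
  alpha : forall e, gmono (eg e) (vg (src e)) }.

Arguments vg : clear implicits.
Arguments eg : clear implicits.
Arguments eg_einv : clear implicits.

Definition omega (A : gog) (e : edge A) : gmono (eg A e) (vg A (tgt e)) :=
  gmono_comp (alpha (einv e)) (gcast (esym (eg_einv A e))).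

Definition vgcast (A : gog) (u u' : vert A) (p : u = u') :
    gmono (vg A u) (vg A u') :=
  gcast (f_equal (vg A) p).

Definition egcast (A : gog) (e e' : edge A) (p : e = e') :
    gmono (eg A e) (eg A e') :=
  gcast (f_equal (eg A) p).

Lemma vgcast_id (A : gog) (u : vert A) (p : u = u) x : vgcast p x = x.
Proof. exact: gcast_id. Qed.

Lemma egcast_id (A : gog) (u : edge A) (p : u = u) x : egcast p x = x.
Proof. exact: gcast_id. Qed.

Lemma vgcast_comp (A : gog) (u v w : vert A) (p : u = v) (q : v = w) x :
  vgcast q (vgcast p x) = vgcast (etrans p q) x.
Proof. by subst. Qed.

Lemma vgcast_irr (A : gog) (u v : vert A) (p q : u = v) x : vgcast p x = vgcast q x.
Proof. exact: gcast_irr. Qed.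

Lemma vgcastK (A : gog) (u v : vert A) (p : u = v) (q : v = u) x :
  vgcast q (vgcast p x) = x.
Proof. by rewrite vgcast_comp vgcast_id. Qed.

Record gmor (X Y : graph) := Gmor {
  mv : vert X -> vert Y;
  me : edge X -> edge Y;
  src_me : forall f, src (me f) = mv (src f);
  me_einv : forall f, me (einv f) = einv (me f) }.

Arguments src_me {X Y}.
Arguments me_einv {X Y}.

Lemma tgt_me (X Y : graph) (m : gmor X Y) (f : edge X) :
  tgt (me m f) = mv m (tgt f).
Proof. by rewrite /tgt -src_me me_einv. Qed.

Lemma gmor_eq (X Y : graph) (m n : gmor X Y) :
  mv m =1 mv n -> me m =1 me n -> m = n.
Proof.
case: m n => [v e s i] [v' e' s' i'] /= /funext p /funext q; subst.
by rewrite (Prop_irrelevance s s') (Prop_irrelevance i i').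
Qed.

(* [twa f] is the twisting element f_alpha. As [tgt f] is [src (einv f)], the
   element f_omega = (f^-1)_alpha is [twa (einv f)]. As [x ^ y] is
   y^-1 x y, gamma_g(x) is [x ^ g]. *)
Record mor (B A : gog) := Mor {
  mgr :> gmor B A;
  mvg : forall v, gmono (vg B v) (vg A (mv mgr v));
  meg : forall f, gmono (eg B f) (eg A (me mgr f));
  twa : forall f, vg A (mv mgr (src f));
  mor_alpha : forall f x,
    vgcast (src_me mgr f) (alpha (me mgr f) (meg f x)) =
    mvg (src f) (alpha f x) ^ twa f;
  mor_omega : forall f x,
    vgcast (tgt_me mgr f) (omega (me mgr f) (meg f x)) =
    mvg (tgt f) (omega f x) ^ twa (einv f) }.

Arguments mvg {B A}.
Arguments meg {B A}.
Arguments twa {B A}.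
Arguments mor_alpha {B A}.
Arguments mor_omega {B A}.

Definition emcast (B A : gog) (m : gmor B A) (f : edge B) :
    gmono (eg A (me m (einv f))) (eg A (me m f)) :=
  gcast (etrans (f_equal (eg A) (me_einv m f)) (eg_einv A (me m f))).

Lemma alpha_egcast (A : gog) (e e' : edge A) (p : e = e') (q : src e = src e') x :
  alpha e' (egcast p x) = vgcast q (alpha e x).
Proof. by subst; rewrite egcast_id vgcast_id. Qed.

Lemma omega_emcast (B A : gog) (m : gmor B A) (f : edge B) (x : eg A (me m (einv f))) :
  vgcast (tgt_me m f) (omega (me m f) (emcast m f x)) =
  vgcast (src_me m (einv f)) (alpha _ x).
Proof.
rewrite /omega /emcast gmono_compE gcast_comp.
have -> y : gcast (etrans (etrans (f_equal (eg A) (me_einv m f))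
                (eg_einv A (me m f))) (esym (eg_einv A (me m f)))) y =
        egcast (me_einv m f) y.
  by rewrite /egcast; exact: gcast_irr.
rewrite (alpha_egcast _ (f_equal (@src A) (me_einv m f))) vgcast_comp.
exact: vgcast_irr.
Qed.

(* mu_f and mu_{f^-1} coincide, up to the identifications A_{f^-1} = A_f. *)
Lemma meg_einv (B A : gog) (m : mor B A) (f : edge B) (x : eg B (einv f)) :
  meg m f (gcast (eg_einv B f) x) = emcast m f (meg m (einv f) x).
Proof.
apply/(gmono_inj (omega _))/(gmono_inj (vgcast (tgt_me m f))).
rewrite mor_omega omega_emcast mor_alpha /omega gmono_compE gcast_comp.
by rewrite gcast_id.
Qed.

Lemma meg_omega (B A : gog) (m : gmor B A)
  (mvg : forall v, gmono (vg B v) (vg A (mv m v)))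
  (meg : forall f, gmono (eg B f) (eg A (me m f)))
  (twa : forall f, vg A (mv m (src f))) :
  (forall f x,
    vgcast (src_me m f) (alpha (me m f) (meg f x)) =
    mvg (src f) (alpha f x) ^ twa f) ->
  (forall f x, meg f (gcast (eg_einv B f) x) = emcast m f (meg (einv f) x)) ->
  forall f x,
    vgcast (tgt_me m f) (omega (me m f) (meg f x)) =
    mvg (tgt f) (omega f x) ^ twa (einv f).
Proof.
move=> ha hi f x.
have -> : x = gcast (eg_einv B f) (gcast (esym (eg_einv B f)) x).
  by rewrite gcast_comp gcast_id.
rewrite hi omega_emcast ha /omega gmono_compE.
by rewrite (gcast_comp (eg_einv B f)) gcast_id.
Qed.

(* The square for omega at [f] is the square for alpha at [f^-1] as soon as
   mu_f and mu_{f^-1} coincide. *)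
Definition mor_of (B A : gog) (m : gmor B A)
    (mvg : forall v, gmono (vg B v) (vg A (mv m v)))
    (meg : forall f, gmono (eg B f) (eg A (me m f)))
    (twa : forall f, vg A (mv m (src f)))
    (ha : forall f x,
      vgcast (src_me m f) (alpha (me m f) (meg f x)) =
      mvg (src f) (alpha f x) ^ twa f)
    (hi : forall f x,
      meg f (gcast (eg_einv B f) x) = emcast m f (meg (einv f) x)) : mor B A :=
  @Mor B A m mvg meg twa ha (meg_omega ha hi).

Definition gmor_id (X : graph) : gmor X X :=
  @Gmor X X id id (fun _ => erefl) (fun _ => erefl).

Definition gmor_comp (X Y Z : graph) (n : gmor Y Z) (m : gmor X Y) : gmor X Z :=
  @Gmor X Z (mv n \o mv m) (me n \o me m)
    (fun f => etrans (src_me n (me m f)) (f_equal (mv n) (src_me m f)))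
    (fun f => etrans (f_equal (me n) (me_einv m f)) (me_einv n (me m f))).

Definition mor_id (A : gog) : mor A A.
Proof.
refine (@Mor A A (gmor_id A) (fun v => gmono_id _) (fun f => gmono_id _)
  (fun f => 1) _ _) => f x.
- by rewrite vgcast_id conjg1.
- by rewrite vgcast_id conjg1.
Defined.

Lemma mvg_vgcast (B A : gog) (m : mor B A) (u v : vert B) (p : u = v)
    (q : mv m u = mv m v) x : mvg m v (vgcast p x) = vgcast q (mvg m u x).
Proof. by subst; rewrite !vgcast_id. Qed.

Lemma meg_gcast (B A : gog) (m : mor B A) (e e' : edge B) (p : e = e') x :
  meg m e' (gcast (f_equal (eg B) p) x) =
  gcast (f_equal (eg A) (f_equal (me m) p)) (meg m e x).
Proof. by case: _ / p. Qed.

Section Comp.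
Context (C B A : gog) (n : mor B A).

Lemma comp_alpha_edge (m : gmor C B) f x :
  vgcast (src_me (gmor_comp n m) f) (alpha (me n (me m f)) (meg n _ x)) =
  mvg n _ (vgcast (src_me m f) (alpha (me m f) x))
    ^ vgcast (f_equal (mv n) (src_me m f)) (twa n (me m f)).
Proof.
rewrite (mvg_vgcast _ (f_equal (mv n) (src_me m f))) -gmulfJ -mor_alpha.
by rewrite vgcast_comp.
Qed.

Lemma emcast_comp (m : gmor C B) f x :
  emcast (gmor_comp n m) f (meg n _ x) = meg n _ (emcast m f x).
Proof.
rewrite {2}/emcast -gcast_comp meg_einv meg_gcast /emcast !gcast_comp.
exact: gcast_irr.
Qed.

Lemma comp_alpha (m : mor C B) f x :
  vgcast (src_me (gmor_comp n m) f) (alpha (me n (me m f)) (meg n _ (meg m f x))) =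
  mvg n _ (mvg m (src f) (alpha f x))
   ^ (mvg n _ (twa m f) *
      vgcast (f_equal (mv n) (src_me m f)) (twa n (me m f))).
Proof. by rewrite conjgM -gmulfJ -mor_alpha comp_alpha_edge. Qed.

Lemma comp_einv (m : mor C B) f x :
  meg n _ (meg m f (gcast (eg_einv C f) x)) =
  emcast (gmor_comp n m) f (meg n _ (meg m (einv f) x)).
Proof. by rewrite meg_einv emcast_comp. Qed.

End Comp.

Definition mor_comp (C B A : gog) (n : mor B A) (m : mor C B) : mor C A :=
  @mor_of C A (gmor_comp n m)
    (fun v => gmono_comp (mvg n (mv m v)) (mvg m v))
    (fun f => gmono_comp (meg n (me m f)) (meg m f))
    (fun f => mvg n (mv m (src f)) (twa m f) *
              vgcast (f_equal (mv n) (src_me m f)) (twa n (me m f)))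
    (comp_alpha n m) (comp_einv n m).

(* [a] and [b] are the families (a_v) and (a_f) witnessing the equivalence. *)
Definition approx_by (B A : gog) (m1 m2 : mor B A)
    (hv : forall v, mv m1 v = mv m2 v) (he : forall f, me m1 f = me m2 f)
    (a : forall v, vg A (mv m1 v)) (b : forall f, eg A (me m1 f)) : Prop :=
  [/\ forall f, emcast m1 f (b (einv f)) = b f,
      forall v x, mvg m2 v x = vgcast (hv v) (mvg m1 v x ^ a v) &
      forall f, a (src f) =
        twa m1 f * vgcast (src_me m1 f) (alpha (me m1 f) (b f)) *
        (vgcast (esym (hv (src f))) (twa m2 f))^-1].

Definition approx_at (B A : gog) (v0 : vert B) (m1 m2 : mor B A) : Prop :=
  exists hv he a b, @approx_by B A m1 m2 hv he a b /\ a v0 = 1.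

Lemma approx_refl B A v0 (m : mor B A) : approx_at v0 m m.
Proof.
exists (fun _ => erefl), (fun _ => erefl), (fun _ => 1), (fun _ => 1).
split=> //; split=> [f|v x|f]; rewrite ?gmulf1 //.
- by rewrite vgcast_id conjg1.
- by rewrite vgcast_id mulg1 mulgV.
Qed.

(* Morphisms with the same underlying graph morphism. *)
Definition approx_on (B A : gog) (m1 m2 : mor B A) (g : mgr m1 = mgr m2)
    (a : forall v, vg A (mv m1 v)) (b : forall f, eg A (me m1 f)) : Prop :=
  [/\ forall f, emcast m1 f (b (einv f)) = b f,
      forall v x, mvg m2 v x =
         vgcast (f_equal (fun g : gmor B A => mv g v) g) (mvg m1 v x ^ a v) &
      forall f, twa m2 f =
        vgcast (f_equal (fun g : gmor B A => mv g (src f)) g)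
         ((a (src f))^-1 *
        (twa m1 f * vgcast (src_me m1 f) (alpha (me m1 f) (b f))))].

Lemma approx_byP B A v0 (m1 m2 : mor B A) :
  approx_at v0 m1 m2 <-> exists g a b, @approx_on B A m1 m2 g a b /\ a v0 = 1.
Proof.
split.
- case=> hv [he] [a] [b] [[h1 h2 h3] h4].
  have g := gmor_eq hv he.
  exists g, a, b; split=> //; split=> // [v x|f].
  - by rewrite h2; exact: vgcast_irr.
  - rewrite {}h3 invgM invgK -!mulgA mulVg mulg1.
    by rewrite vgcastK.
- case=> g [a] [b] [[h1 h2 h3] h4].
  exists (fun v => f_equal (fun g : gmor B A => mv g v) g).
  exists (fun v => f_equal (fun g : gmor B A => me g v) g).
  exists a, b; split=> //; split=> // f.
  by rewrite h3 vgcastK invgM invgK mulgA mulgV mul1g.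
Qed.

Lemma approx_sym B A v0 (m1 m2 : mor B A) :
  approx_at v0 m1 m2 -> approx_at v0 m2 m1.
Proof.
case: m1 m2 => [g1 mv1 me1 tw1 x1 y1] [g2 mv2 me2 tw2 x2 y2].
move=> /approx_byP [/= g [a [b [[/= h1 h2 h3] h4]]]]; apply/approx_byP => /=.
subst g2; exists erefl.
exists (fun v => (a v)^-1), (fun f => (b f)^-1); split; last by rewrite /= h4 invg1.
split=> [f|v x|f] /=.
- by rewrite gmulfV h1.
- by rewrite h2 !vgcast_id -conjgM mulgV conjg1.
- by rewrite h3 !vgcast_id invgK !gmulfV -mulgA mulgK mulVKg.
Qed.

Lemma approx_trans B A v0 (m1 m2 m3 : mor B A) :
  approx_at v0 m1 m2 -> approx_at v0 m2 m3 -> approx_at v0 m1 m3.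
Proof.
case: m1 m2 m3 => [g1 mv1 me1 tw1 x1 y1] [g2 mv2 me2 tw2 x2 y2]
  [g3 mv3 me3 tw3 x3 y3].
move=> /approx_byP [/= g [a [b [[/= h1 h2 h3] h4]]]].
move=> /approx_byP [/= g' [a' [b' [[/= h1' h2' h3'] h4']]]].
apply/approx_byP => /=; subst g2 g3; exists erefl.
exists (fun v => a v * a' v), (fun f => b f * b' f).
split; last by rewrite /= h4 h4' mulg1.
split=> [f|v x|f] /=.
- by rewrite gmulfM h1 h1'.
- by rewrite h2' h2 !vgcast_id conjgM.
- by rewrite h3' h3 !vgcast_id !gmulfM invgM !mulgA.
Qed.

Lemma approx_compl C B A v0 (n : mor B A) (m1 m2 : mor C B) :
  approx_at v0 m1 m2 -> approx_at v0 (mor_comp n m1) (mor_comp n m2).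
Proof.
case: m1 m2 => [g1 mv1 me1 tw1 x1 y1] [g2 mv2 me2 tw2 x2 y2].
move=> /approx_byP [/= g [a [b [[/= h1 h2 h3] h4]]]]; apply/approx_byP => /=.
subst g2; exists erefl.
exists (fun v => mvg n _ (a v)), (fun f => meg n _ (b f)).
split; last by rewrite /= h4 gmulf1.
split=> [f|v x|f] /=.
- by rewrite emcast_comp h1.
- by rewrite h2 !vgcast_id gmulfJ.
- rewrite h3 !vgcast_id comp_alpha_edge !gmulfM !gmulfV /= -!mulgA.
  by congr (_ * (_ * _)); rewrite -conjgC.
Qed.

Lemma approx_compr C B A v0 (n1 n2 : mor B A) (m : mor C B) :
  approx_at (mv m v0) n1 n2 -> approx_at v0 (mor_comp n1 m) (mor_comp n2 m).
Proof.
case: n1 n2 => [g1 mv1 me1 tw1 x1 y1] [g2 mv2 me2 tw2 x2 y2].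
move=> /approx_byP [/= g [a [b [[/= h1 h2 h3] h4]]]]; apply/approx_byP => /=.
subst g2; exists erefl.
exists (fun v => a (mv m v)), (fun f => b (me m f)).
split; last by [].
have ha (u v : vert B) (p : u = v) (q : mv g1 u = mv g1 v) : vgcast q (a u) = a v.
  by subst; rewrite vgcast_id.
split=> [f|v x|f] /=.
- rewrite -[in RHS]h1 /emcast.
  have -> : b (einv (me m f)) =
    gcast (f_equal (eg A) (f_equal (me g1) (me_einv m f))) (b (me m (einv f))).
    by case: _ / (me_einv m f).
  by rewrite gcast_comp; exact: gcast_irr.
- by rewrite h2 !vgcast_id.
- rewrite h2 h3 !vgcast_id !gmulfM gmulfV /= (ha _ _ (src_me m f)) vgcast_comp.
  by rewrite /conjg !mulgA mulgK.
Qed.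

Lemma approx_eq B A v0 (m1 m2 : mor B A) (g : mgr m1 = mgr m2) :
  (forall v x, mvg m2 v x =
     vgcast (f_equal (fun g : gmor B A => mv g v) g) (mvg m1 v x)) ->
  (forall f, twa m2 f =
     vgcast (f_equal (fun g : gmor B A => mv g (src f)) g) (twa m1 f)) ->
  approx_at v0 m1 m2.
Proof.
move=> h1 h2; apply/approx_byP.
exists g, (fun _ => 1), (fun _ => 1); split=> //; split=> [f|v x|f].
- by rewrite gmulf1.
- by rewrite h1 conjg1.
- by rewrite h2 !gmulf1 invg1 mul1g mulg1.
Qed.

Lemma mor_compA D C B A v0 (n : mor B A) (m : mor C B) (l : mor D C) :
  approx_at v0 (mor_comp n (mor_comp m l)) (mor_comp (mor_comp n m) l).
Proof.
have g : mgr (mor_comp n (mor_comp m l)) = mgr (mor_comp (mor_comp n m) l).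
  exact: gmor_eq.
apply: (@approx_eq _ _ _ _ _ g) => [v x|f]; rewrite vgcast_id //=.
rewrite !gmulfM -!mulgA vgcast_comp.
rewrite (mvg_vgcast _ (f_equal (mv n) (f_equal (mv m) (src_me l f)))).
by congr (_ * _); congr (_ * _); apply: vgcast_irr.
Qed.

Lemma mor_comp1m B A v0 (m : mor B A) : approx_at v0 (mor_comp (mor_id A) m) m.
Proof.
have g : mgr (mor_comp (mor_id A) m) = mgr m by exact: gmor_eq.
apply: (@approx_eq _ _ _ _ _ g) => [v x|f]; rewrite vgcast_id //=.
by rewrite gmulf1 mulg1.
Qed.

Lemma mor_compm1 B A v0 (m : mor B A) : approx_at v0 (mor_comp m (mor_id B)) m.
Proof.
have g : mgr (mor_comp m (mor_id B)) = mgr m by exact: gmor_eq.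
apply: (@approx_eq _ _ _ _ _ g) => [v x|f]; rewrite vgcast_id //=.
by rewrite gmulf1 mul1g.
Qed.

Inductive reach (X : graph) (u : vert X) : vert X -> Prop :=
| reach_refl : reach u u
| reach_step e : reach u (src e) -> reach u (tgt e).

Definition connected (X : graph) : Prop := forall u v : vert X, reach u v.

Record pgog := Pgog {
  pg :> gog;
  pt : vert pg;
  pg_connected : connected pg }.

Record pmor (B A : pgog) := Pmor {
  pm :> mor B A;
  pm_pt : mv pm (pt B) = pt A }.

Definition pmor_id (A : pgog) : pmor A A := @Pmor A A (mor_id A) erefl.

Definition pmor_comp (C B A : pgog) (n : pmor B A) (m : pmor C B) : pmor C A :=
  @Pmor C A (mor_comp n m) (etrans (f_equal (mv n) (pm_pt m)) (pm_pt n)).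

Definition sim (B A : pgog) (m1 m2 : pmor B A) : Prop :=
  approx_at (pt B) m1 m2.

Lemma sim_comp (C B A : pgog) (n1 n2 : pmor B A) (m1 m2 : pmor C B) :
  sim n1 n2 -> sim m1 m2 -> sim (pmor_comp n1 m1) (pmor_comp n2 m2).
Proof.
move=> hn hm; apply: approx_trans (approx_compl n1 hm) _.
by apply: approx_compr; rewrite (pm_pt m2).
Qed.

Record category := Category {
  ob :> Type;
  hom : ob -> ob -> Type;
  idm : forall x, hom x x;
  compm : forall x y z, hom y z -> hom x y -> hom x z;
  compmA : forall w x y z (h : hom y z) (g : hom x y) (f : hom w x),
    compm h (compm g f) = compm (compm h g) f;
  comp1m : forall x y (f : hom x y), compm (idm y) f = f;
  compm1 : forall x y (f : hom x y), compm f (idm x) = f }.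

Definition is_pullback (X : category) (a b c p : X)
    (f : hom b a) (g : hom c a) (r : hom p b) (s : hom p c) : Prop :=
  compm f r = compm g s /\
  forall (q : X) (x : hom q b) (y : hom q c), compm f x = compm g y ->
    exists! z : hom q p, compm r z = x /\ compm s z = y.

Record arrow (B A : pgog) := Arrow {
  arrow_set : set (pmor B A);
  arrow_class : exists m, arrow_set = [set m' | sim m m'] }.

Definition cls (B A : pgog) (m : pmor B A) : arrow B A :=
  @Arrow B A [set m' | sim m m'] (ex_intro _ m erefl).

Lemma arrow_eq (B A : pgog) (X Y : arrow B A) : arrow_set X = arrow_set Y -> X = Y.
Proof.
case: X Y => X hX [Y hY] /= e; subst Y.
by rewrite (Prop_irrelevance hX hY).
Qed.

Lemma cls_eq (B A : pgog) (m n : pmor B A) : cls m = cls n <-> sim m n.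
Proof.
split=> [e|mn].
  have : arrow_set (cls n) n by apply: approx_refl.
  by rewrite -e.
apply: arrow_eq; rewrite eqEsubset; split=> x /=.
- by apply: approx_trans; apply: approx_sym.
- exact: approx_trans.
Qed.

Lemma arrowP (B A : pgog) (X : arrow B A) : exists m, X = cls m.
Proof. by case: X => X [m e]; exists m; apply: arrow_eq. Qed.

Lemma arrow_comp_class (C B A : pgog) (Y : arrow B A) (X : arrow C B) :
  exists r, [set s | exists n m, [/\ arrow_set Y n, arrow_set X m & sim (pmor_comp n m) s]] =
            [set s | sim r s].
Proof.
have [n ->] := arrowP Y; have [m ->] := arrowP X; exists (pmor_comp n m).
rewrite eqEsubset; split=> s /=.
- case=> n' [m' [hn hm]]; apply: approx_trans; exact: sim_comp.
- by move=> h; exists n, m; split=> //; apply: approx_refl.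
Qed.

(* The ~-class of the composites of representatives. *)
Definition arrow_comp (C B A : pgog) (Y : arrow B A) (X : arrow C B) :
    arrow C A :=
  Arrow (arrow_comp_class Y X).

Lemma arrow_comp_cls (C B A : pgog) (n : pmor B A) (m : pmor C B) :
  arrow_comp (cls n) (cls m) = cls (pmor_comp n m).
Proof.
apply: arrow_eq; rewrite eqEsubset; split=> s /=.
- case=> n' [m' [hn hm]]; apply: approx_trans; exact: sim_comp.
- by move=> h; exists n, m; split=> //; apply: approx_refl.
Qed.

Definition GrGp_pt : category.
Proof.
refine (@Category pgog arrow (fun A => cls (pmor_id A)) arrow_comp _ _ _).
- move=> D C B A n m l.
  have [{}n ->] := arrowP n; have [{}m ->] := arrowP m; have [{}l ->] := arrowP l.
  by rewrite !arrow_comp_cls; apply/cls_eq; apply: mor_compA.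
- move=> B A m; have [{}m ->] := arrowP m.
  by rewrite !arrow_comp_cls; apply/cls_eq; apply: mor_comp1m.
- move=> B A m; have [{}m ->] := arrowP m.
  by rewrite !arrow_comp_cls; apply/cls_eq; apply: mor_compm1.
Defined.

Lemma reach_trans (X : graph) (u v w : vert X) :
  reach u v -> reach v w -> reach u w.
Proof. by move=> uv; elim=> // e _; apply: reach_step. Qed.

Lemma reach_sym (X : graph) (u v : vert X) : reach u v -> reach v u.
Proof.
elim=> [|e _ ih]; first exact: reach_refl.
apply: reach_trans ih; rewrite -tgt_einv; apply: reach_step; exact: reach_refl.
Qed.

Section Component.
Context (A : gog) (u0 : vert A).

Definition cpt_vert : Type := {v : vert A | reach u0 v}.
Definition cpt_edge : Type := {e : edge A | reach u0 (src e)}.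

Definition cpt_src (e : cpt_edge) : cpt_vert := exist _ (src (sval e)) (proj2_sig e).

Definition cpt_inv (e : cpt_edge) : cpt_edge :=
  exist (fun e => reach u0 (src e)) (einv (sval e)) (reach_step (proj2_sig e)).

Lemma cpt_invK : involutive cpt_inv.
Proof. by case=> e p; apply: eq_exist; apply: einvK. Qed.

Lemma cpt_inv_free e : cpt_inv e <> e.
Proof. by move=> /(f_equal sval); apply: einv_free. Qed.

Definition cpt_graph : graph :=
  @Graph cpt_vert cpt_edge cpt_src cpt_inv cpt_invK cpt_inv_free.

Definition component : gog :=
  @Gog cpt_graph (fun v => vg A (sval v)) (fun e => eg A (sval e))
    (fun e => eg_einv A (sval e)) (fun e => @alpha A (sval e)).

Definition cpt_base : vert component := exist _ u0 (reach_refl u0).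

Lemma component_connected : connected component.
Proof.
have h v (r0 : reach u0 v) : forall r, reach cpt_base (exist _ v r).
  elim: r0 => [|e re ih] r.
    by rewrite (Prop_irrelevance r (reach_refl u0)); apply: reach_refl.
  have /= := @reach_step cpt_graph cpt_base (exist _ e re) (ih re).
  rewrite /tgt /cpt_src /=.
  by rewrite (Prop_irrelevance r (reach_step re)).
move=> [u ru] [v rv]; apply: reach_trans (h v rv rv).
exact/reach_sym/h.
Qed.

Definition incl : mor component A.
Proof.
refine (@mor_of component A
  (@Gmor component A sval sval (fun _ => erefl) (fun _ => erefl))
  (fun v => gmono_id _) (fun f => gmono_id _) (fun f => 1) _ _) => f x.
- by rewrite vgcast_id conjg1.
- exact: gcast_irr.
Defined.

End Component.

Arguments cpt_base {A}.

Definition pcomponent (A : gog) (u0 : vert A) : pgog :=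
  @Pgog (component u0) (cpt_base u0) (@component_connected A u0).

Definition dcoset (G H K : groupType) (m : gmono G K) (n : gmono H K) (a : K) :
    set K :=
  [set x | exists b c, x = m b * a * n c].

(* D = {(b, c) in G x H | k^-1 m(b) k = n(c)}; the equality is decidable since a
   [groupType] is a [choiceType]. *)
Section Fibre.
Context (G H K : groupType) (m : gmono G K) (n : gmono H K) (k : K).

Definition fibre_pred : pred (G * H) := fun x => m x.1 ^ k == n x.2.

Lemma fibre_closed : group_closed fibre_pred.
Proof.
split; first by rewrite /fibre_pred unfold_in /= !gmulf1 conj1g.
move=> x y; rewrite !unfold_in /fibre_pred /= => /eqP hx /eqP hy.
by rewrite !gmulfF conjMg conjVg hx hy.
Qed.

Definition fibre_type : Type := {x : G * H | fibre_pred x}.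
HB.instance Definition _ := SubChoice.on fibre_type.
HB.instance Definition _ :=
  SubChoice_isSubGroup.Build (G * H)%type fibre_pred fibre_type fibre_closed.

Definition fibre : groupType := fibre_type.

Definition fib_mk (b : G) (c : H) (e : m b ^ k = n c) : fibre :=
  exist fibre_pred (b, c) (introT eqP e).

Lemma fibP (x : fibre) : m (sval x).1 ^ k = n (sval x).2.
Proof. exact: (elimT eqP (svalP x)). Qed.

Lemma fib_inj1 : injective (fun x : fibre => (sval x).1).
Proof.
move=> x y e; have := fibP x; rewrite e fibP => /gmono_inj e2.
apply: (@val_inj _ fibre_pred fibre_type) => /=; move: (sval x) (sval y) e e2 => [b c] [b' c'] /=.
by move=> -> ->.
Qed.

Lemma fib_inj2 : injective (fun x : fibre => (sval x).2).
Proof.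
move=> x y e; have := fibP x; rewrite e -fibP => /conjg_inj /gmono_inj e2.
apply: (@val_inj _ fibre_pred fibre_type) => /=; move: (sval x) (sval y) e e2 => [b c] [b' c'] /=.
by move=> -> ->.
Qed.

Definition fib1 : gmono fibre G :=
  @gmono_of fibre G (fun x => (sval x).1) (fun _ _ => erefl) fib_inj1.

Definition fib2 : gmono fibre H :=
  @gmono_of fibre H (fun x => (sval x).2) (fun _ _ => erefl) fib_inj2.

Lemma fib_rel (x : fibre) : m (fib1 x) ^ k = n (fib2 x).
Proof. exact: fibP. Qed.

End Fibre.

Arguments fib1 {G H K m n k}.
Arguments fib2 {G H K m n k}.

Lemma dcoset_mul (G H K : groupType) (m : gmono G K) (n : gmono H K) b a c :
  dcoset m n (m b * a * n c) = dcoset m n a.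
Proof.
rewrite eqEsubset; split=> x [b' [c' ->]].
- by exists (b' * b), (c * c'); rewrite !gmulfM !mulgA.
- exists (b' / b), (c^-1 * c'); rewrite !gmulfM !gmulfV !mulgA mulgVK.
  by rewrite -[_ * n c / n c]mulgA mulgV mulg1.
Qed.

Lemma dcoset_refl (G H K : groupType) (m : gmono G K) (n : gmono H K) a :
  dcoset m n a a.
Proof. by exists 1, 1; rewrite !gmulf1 mulg1 mul1g. Qed.

Lemma fibre_eq (G H K G' H' K' : groupType) (m : gmono G K) (n : gmono H K)
    (m' : gmono G' K') (n' : gmono H' K') (k : K) (k' : K')
    (eG : G' = G) (eH : H' = H) (eK : K' = K) :
  (forall x, m (gcast eG x) = gcast eK (m' x)) ->
  (forall x, n (gcast eH x) = gcast eK (n' x)) ->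
  gcast eK k' = k ->
  fibre m' n' k' = fibre m n k.
Proof.
by subst => /= hm hn <-; rewrite (gmono_eq hm) (gmono_eq hn).
Qed.

Lemma fib_gcast (G H K G' H' K' : groupType) (m : gmono G K) (n : gmono H K)
    (m' : gmono G' K') (n' : gmono H' K') (k : K) (k' : K')
    (eG : G' = G) (eH : H' = H) (eK : K' = K)
    (e : fibre m' n' k' = fibre m n k) :
  (forall x, m (gcast eG x) = gcast eK (m' x)) ->
  (forall x, n (gcast eH x) = gcast eK (n' x)) ->
  gcast eK k' = k ->
  forall x, fib1 (gcast e x) = gcast eG (fib1 x) /\
            fib2 (gcast e x) = gcast eH (fib2 x).
Proof.
move=> hm hn hk; subst; move: hm hn => /= /gmono_eq em /gmono_eq en; subst.
by move=> x; rewrite gcast_id.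
Qed.

Section Product.
Context (A B C : gog) (muB : mor B A) (muC : mor C A).

(* Both sides of a double coset live in the group over the image of the
   [B]-coordinate; that of the [C]-coordinate is transported to it. *)
Definition vright v w (p : mv muB v = mv muC w) :
    gmono (vg C w) (vg A (mv muB v)) :=
  gmono_comp (vgcast (esym p)) (mvg muC w).

Definition eright f g (p : me muB f = me muC g) :
    gmono (eg C g) (eg A (me muB f)) :=
  gmono_comp (egcast (esym p)) (meg muC g).

Record pvert := PVert {
  vB : vert B;
  vC : vert C;
  vBC : mv muB vB = mv muC vC;
  vX : set (vg A (mv muB vB));
  vXP : exists a, vX = dcoset (mvg muB vB) (vright vBC) a }.

Record pedge := PEdge {
  eB : edge B;
  eC : edge C;
  eBC : me muB eB = me muC eC;
  eX : set (eg A (me muB eB));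
  eXP : exists a, eX = dcoset (meg muB eB) (eright eBC) a }.

Arguments vX : clear implicits.
Arguments eX : clear implicits.

Lemma pedge_eq (h h' : pedge) (p : eB h = eB h') (q : eC h = eC h') :
  (forall a, eX h a <-> eX h' (egcast (f_equal (me muB) p) a)) -> h = h'.
Proof.
case: h h' p q => f g r Y hY [f' g' r' Y' hY'] /= p q; subst.
have e := Prop_irrelevance r r'; subst => h.
have e : Y = Y' by rewrite predeqE => a; rewrite h.
by subst; rewrite (Prop_irrelevance hY hY').
Qed.

Lemma pinv_fe h : me muB (einv (eB h)) = me muC (einv (eC h)).
Proof. by rewrite !me_einv eBC. Qed.

(* The double coset [h] itself, read in A_{e^-1} = A_e. *)
Definition pinv_set (h : pedge) : set (eg A (me muB (einv (eB h)))) :=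
  [set a | eX h (emcast muB (eB h) a)].

Arguments pinv_set : clear implicits.

Lemma eright_einv (h : pedge) x :
  eright (eBC h) (gcast (eg_einv C (eC h)) x) =
  emcast muB (eB h) (eright (pinv_fe h) x).
Proof.
rewrite /eright !gmono_compE meg_einv /emcast /egcast !gcast_comp.
exact: gcast_irr.
Qed.

Lemma pinv_setP (h : pedge) : exists a,
  pinv_set h = dcoset (meg muB (einv (eB h))) (eright (pinv_fe h)) a.
Proof.
have [a ea] := eXP h; rewrite /pinv_set ea.
exists (gcast (esym (etrans (f_equal (eg A) (me_einv muB (eB h))) (eg_einv A _))) a).
set a' := gcast _ a.
have -> : a = emcast muB (eB h) a' by rewrite /emcast gcast_comp gcast_id.
rewrite eqEsubset; split=> x /= [b [c hx]].
- exists (gcast (esym (eg_einv B _)) b), (gcast (esym (eg_einv C _)) c).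
  apply/(gmono_inj (emcast muB (eB h))); rewrite hx !gmulfM.
  by rewrite -meg_einv -eright_einv !gcast_comp !gcast_id.
- exists (gcast (eg_einv B _) b), (gcast (eg_einv C _) c).
  by rewrite hx !gmulfM meg_einv eright_einv.
Qed.

Definition pinv (h : pedge) : pedge := PEdge (pinv_setP h).

Lemma pinvK : involutive pinv.
Proof.
move=> h; apply: (@pedge_eq (pinv (pinv h)) h (einvK _) (einvK _)) => a /=.
rewrite /pinv_set /= /pinv_set /= /emcast /egcast gcast_comp.
by set p := etrans _ _; rewrite (gcast_irr p (f_equal (eg A) (f_equal (me muB) (einvK (eB h))))).
Qed.

Lemma pinv_free h : pinv h <> h.
Proof. by move=> /(f_equal eB); apply: einv_free. Qed.

Lemma psrc_vw (h : pedge) : mv muB (src (eB h)) = mv muC (src (eC h)).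
Proof. by rewrite -!src_me eBC. Qed.

(* f_alpha alpha_e(a) g_alpha^-1. *)
Definition porig (h : pedge) (a : eg A (me muB (eB h))) :
    vg A (mv muB (src (eB h))) :=
  twa muB (eB h) * vgcast (src_me muB (eB h)) (alpha (me muB (eB h)) a) *
  (vgcast (esym (psrc_vw h)) (twa muC (eC h)))^-1.

Arguments porig : clear implicits.

(* By [porig_mul] this is the double coset of [porig h a] for any [a] in [h]. *)
Definition psrc_set (h : pedge) : set (vg A (mv muB (src (eB h)))) :=
  \bigcup_(a in eX h) dcoset (mvg muB (src (eB h))) (vright (psrc_vw h)) (porig h a).

Arguments psrc_set : clear implicits.

Lemma porig_mul (h : pedge) b a c :
  porig h (meg muB (eB h) b * a * eright (eBC h) c) =
  mvg muB _ (alpha (eB h) b) * porig h a * vright (psrc_vw h) (alpha (eC h) c).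
Proof.
rewrite /porig !gmulfM mor_alpha /vright /eright !gmono_compE.
rewrite (alpha_egcast _ (f_equal (@src A) (esym (eBC h)))) vgcast_comp.
rewrite (vgcast_irr _ (etrans (src_me muC (eC h)) (esym (psrc_vw h)))).
rewrite -(vgcast_comp (src_me muC (eC h))) mor_alpha gmulfJ /conjg.
by rewrite !mulgA mulgV mul1g mulgK.
Qed.

Lemma psrc_setP (h : pedge) : exists a, psrc_set h =
  dcoset (mvg muB (src (eB h))) (vright (psrc_vw h)) a.
Proof.
have [a ea] := eXP h; exists (porig h a); rewrite /psrc_set ea.
rewrite eqEsubset; split=> [x [_ [b [c ->]]]|x hx]; last first.
  by exists a => //; apply: dcoset_refl.
by rewrite porig_mul dcoset_mul.
Qed.

Definition psrc (h : pedge) : pvert := PVert (psrc_setP h).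

Definition pgraph : graph := @Graph pvert pedge psrc pinv pinvK pinv_free.

(* [vrep] and [erep] are the representatives of the double cosets; [btw] and
   [ctw] are the families (b_h) and (c_h). *)
Record choices := Choices {
  vrep : forall x : pvert, vg A (mv muB (vB x));
  vrepP : forall x, vX x (vrep x);
  erep : forall h : pedge, eg A (me muB (eB h));
  erepP : forall h, eX h (erep h);
  erep_inv : forall h, emcast muB (eB h) (erep (pinv h)) = erep h;
  btw : forall h, vg B (src (eB h));
  ctw : forall h, vg C (src (eC h));
  twE : forall h, vrep (psrc h) =
    mvg muB (src (eB h)) (btw h) * porig h (erep h) *
    (vright (psrc_vw h) (ctw h))^-1 }.

Variable c : choices.

Definition pvg (x : pvert) : groupType :=
  fibre (mvg muB (vB x)) (vright (vBC x)) (vrep c x).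

Definition peg (h : pedge) : groupType :=
  fibre (meg muB (eB h)) (eright (eBC h)) (erep c h).

Lemma peg_inv h : peg (pinv h) = peg h.
Proof.
exact: (fibre_eq (@meg_einv _ _ muB (eB h)) (@eright_einv h) (erep_inv c h)).
Qed.

Lemma porig_rel h b a d :
  meg muB (eB h) b ^ a = eright (eBC h) d ->
  mvg muB _ (alpha (eB h) b) ^ porig h a = vright (psrc_vw h) (alpha (eC h) d).
Proof.
move=> e; have h1 := porig_mul b a 1; have h2 := porig_mul 1 a d.
rewrite !gmulf1 !mulg1 in h1; rewrite !gmulf1 !mul1g in h2.
by rewrite /conjg -h1 [meg _ _ _ * _]conjgC e h2 mulKg.
Qed.

Lemma palpha_rel h (x : peg h) :
  mvg muB (vB (psrc h)) (btw c h * alpha (eB h) (fib1 x) * (btw c h)^-1)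
    ^ vrep c (psrc h) =
  vright (vBC (psrc h)) (ctw c h * alpha (eC h) (fib2 x) * (ctw c h)^-1).
Proof.
have J (X : groupType) (g z : X) : g * z * g^-1 = z ^ g^-1.
  by rewrite /conjg invgK mulgA.
rewrite twE !J !gmulfJ !gmulfV -conjgM -mulgA mulKg conjgM.

by rewrite (porig_rel (fib_rel x)).
Qed.

Definition palpha_fun h (x : peg h) : pvg (psrc h) := fib_mk (palpha_rel x).

Lemma palphaM h : {morph @palpha_fun h : x y / x * y}.
Proof.
by move=> x y; apply: fib_inj1 => /=; rewrite !gmulfM !mulgA mulgVK.
Qed.

Lemma palpha_inj h : injective (@palpha_fun h).
Proof.
move=> x y /(f_equal fib1) /= /mulIg /mulgI /gmono_inj; exact: fib_inj1.
Qed.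

Definition palpha h : gmono (peg h) (pvg (psrc h)) :=
  gmono_of (@palphaM h) (@palpha_inj h).

Definition aprod : gog := @Gog pgraph pvg peg peg_inv palpha.

Definition prB : mor aprod B.
Proof.
refine (@mor_of aprod B
  (@Gmor pgraph B vB eB (fun _ => erefl) (fun _ => erefl))
  (fun x => fib1) (fun h => fib1) (btw c) _ _) => h x.
- rewrite vgcast_id /= /conjg !mulgA mulgVK mulVg mul1g //.
- have [-> _] := fib_gcast (peg_inv h) (@meg_einv _ _ muB (eB h)) (@eright_einv h)
    (erep_inv c h) x.
  exact: gcast_irr.
Defined.

Definition prC : mor aprod C.
Proof.
refine (@mor_of aprod C
  (@Gmor pgraph C vC eC (fun _ => erefl) (fun _ => erefl))
  (fun x => fib2) (fun h => fib2) (ctw c) _ _) => h x.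
- rewrite vgcast_id /= /conjg !mulgA mulgVK mulVg mul1g //.
- have [_ ->] := fib_gcast (peg_inv h) (@meg_einv _ _ muB (eB h)) (@eright_einv h)
    (erep_inv c h) x.
  exact: gcast_irr.
Defined.

End Product.

Arguments vX {A B C muB muC}.
Arguments eX {A B C muB muC}.
Arguments porig {A B C muB muC}.
Arguments vrep {A B C muB muC}.
Arguments erep {A B C muB muC}.

Section PointedProduct.
Context (A B C : pgog) (muB : pmor B A) (muC : pmor C A).

Lemma pbase_vw : mv muB (pt B) = mv muC (pt C).
Proof. by rewrite !pm_pt. Qed.

Definition pbase : pvert muB muC :=
  @PVert A B C muB muC (pt B) (pt C) pbase_vw
    (dcoset (mvg muB (pt B)) (vright pbase_vw) 1) (ex_intro _ 1 erefl).

Record pchoices := Pchoices {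
  pc :> choices muB muC;
  pc_base : vrep pc pbase = 1 }.

Lemma pchoices_exist : inhabited pchoices.
Proof.
have hv (x : pvert muB muC) : exists a, vX x a /\
    forall e : pbase = x, a = eq_rect pbase (fun x => vg A (mv muB (vB x))) 1 x e.
  have [e|ne] := EM (pbase = x).
    subst x; exists 1; split=> [|e]; first exact: dcoset_refl.
    by rewrite (Prop_irrelevance e erefl).
  by have [a ->] := vXP x; exists a; split=> [|/ne //]; apply: dcoset_refl.
pose r x := sval (cid (hv x)); have hr x := svalP (cid (hv x)).
have he0 (h : pedge muB muC) : exists a, eX h a.
  by have [a ->] := eXP h; exists a; apply: dcoset_refl.
pose e0 h := sval (cid (he0 h)); have he0P h : eX h (e0 h) := svalP (cid (he0 h)).
have e0_cast (h h' : pedge muB muC) (e : h' = h)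
    (p : eg A (me muB (eB h')) = eg A (me muB (eB h))) : gcast p (e0 h') = e0 h.
  by subst; rewrite gcast_id.
have hS (h : pedge muB muC) : exists k, [set k | k = h \/ k = pinv h] k.
  by exists h; left.
pose pick (S : set (pedge muB muC)) (hS : exists k, S k) := sval (cid hS).
pose k h := pick _ (hS h).
have hk h : k h = h \/ k h = pinv h := svalP (cid (hS h)).
have kV h : k (pinv h) = k h.
  rewrite /k; move: (hS (pinv h)) (hS h).
  have -> : [set k | k = pinv h \/ k = pinv (pinv h)] =
            [set k | k = h \/ k = pinv h].
    by rewrite pinvK eqEsubset; split=> y /= [->|->]; [right|left|right|left].
  by move=> p q; rewrite (Prop_irrelevance p q).
have he (h : pedge muB muC) : exists a, [/\ eX h a, k h = h -> a = e0 h &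
    k h = pinv h -> a = emcast muB (eB h) (e0 (pinv h))].
  have [e|e] := hk h.
    exists (e0 h); split=> // e'; case: (@pinv_free _ _ _ _ _ h).
    by rewrite -e' e.
  exists (emcast muB (eB h) (e0 (pinv h))); split=> //; first exact: (he0P (pinv h)).
  by move=> e'; case: (@pinv_free _ _ _ _ _ h); rewrite -e.
pose e1 h := sval (cid (he h)).
have [he1 he2 he3] : [/\ forall h, eX h (e1 h), forall h, k h = h -> e1 h = e0 h &
    forall h, k h = pinv h -> e1 h = emcast muB (eB h) (e0 (pinv h))].
  by split=> h; rewrite /e1; case: (cid (he h)) => a [].
have e1V h : emcast muB (eB h) (e1 (pinv h)) = e1 h.
  have [e|e] := hk h.
    rewrite (he2 h e) (he3 (pinv h)); last by rewrite kV pinvK.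
    by rewrite /emcast gcast_comp; apply: e0_cast; apply: pinvK.
  by rewrite (he3 h e) (he2 (pinv h)) // kV.
have ht h : exists bc : vg B (src (eB h)) * vg C (src (eC h)), r (psrc h) =
    mvg muB (src (eB h)) bc.1 * porig h (e1 h) * (vright (psrc_vw h) bc.2)^-1.
  have [a ha [b [d ->]]] : vX (psrc h) (r (psrc h)) := proj1 (hr (psrc h)).
  have [a0 ea0] := eXP h; have := he1 h; rewrite ea0 => -[b0 [d0 e10]].
  have eY : eX h = dcoset (meg muB (eB h)) (eright (eBC h)) (e1 h).
    by rewrite ea0 e10 dcoset_mul.
  move: ha; rewrite eY => -[b1 [d1 ->]].
  exists (b * alpha _ b1, (alpha _ d1 * d)^-1) => /=.
  by rewrite porig_mul -[(vright _ _)^-1]gmulfV invgK !gmulfM !mulgA.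
pose t h := sval (cid (ht h)); have htP h := svalP (cid (ht h)).
pose c := @Choices _ _ _ muB muC r (fun x => proj1 (hr x)) e1 he1 e1V _ _ htP.
by exists; exists c; apply: (proj2 (hr pbase) erefl).
Qed.

Definition pprod (c : pchoices) : pgog := @pcomponent (aprod c) pbase.

Definition rhoB (c : pchoices) : pmor (pprod c) B :=
  @Pmor (pprod c) B (mor_comp (prB c) (@incl (aprod c) pbase)) erefl.

Definition rhoC (c : pchoices) : pmor (pprod c) C :=
  @Pmor (pprod c) C (mor_comp (prC c) (@incl (aprod c) pbase)) erefl.

End PointedProduct.

(* Main.v *)
From mathcomp Require Import all_boot.
From mathcomp Require Import boolp classical_sets.
Require Import Defs.

(** Call a family (a_v), (a_f) as in the definition of the equivalence of two
    morphisms a homotopy between them.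

    A pair of morphisms sB : Q -> B, sC : Q -> C with a homotopy from muB sB to
    muC sC names, at each vertex v of Q, an element a_v of the group of A over
    sB(v) and sC(v), hence a double coset, hence a vertex of the product; and
    likewise for edges.  The condition linking a_v to a_f at the origin of f
    says that this is a graph morphism.  So a pair (sB, sC) with a homotopy has a
    canonical graph morphism into the product.

    Existence.  Conjugating sB and sC moves a_v inside its double coset
    ([edge_adjust], [vertex_adjust]), so one may assume that a_v and a_f are the
    chosen representatives.  Then (sB, sC) takes its values in the fibres that
    are the groups of the product, and dividing the twisting elements of sB and sC
    by b_h and c_h gives the twisting elements of a lift ([lift]).

    Uniqueness.  The representatives themselves form a homotopy from
    muB prB t to muC prC t for every t : Q -> product ([canonical_by]).  Given
    homotopies from prB t to prB t' and from prC t to prC t', there are two ways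
    to go from muB prB t to muC prC t'.  Over a connected Q a homotopy is determined
    by its value at one vertex ([approx_by_rigid]), so the two ways agree.  This
    equation says both that t and t' have the same underlying graph morphism and
    that the two given homotopies form a pair with values in the groups of the
    product ([rep_transport]), that is, a homotopy from t to t'.

    Passing to the component of the base vertex costs nothing: a connected
    source maps into it ([corestr]), and its inclusion is a monomorphism
    ([incl_monic]). *)

Set Implicit Arguments.
Unset Strict Implicit.
Unset Printing Implicit Defensive.

Local Open Scope classical_set_scope.
Local Open Scope group_scope.

Arguments btw {A B C muB muC}.
Arguments ctw {A B C muB muC}.

(** * Homotopies of morphisms *)

Section Homotopies.
Context (B A : gog).
Implicit Types m : mor B A.

Lemma approx_by_irr m1 m2 hv he hv' he' a b :
  @approx_by B A m1 m2 hv he a b -> @approx_by B A m1 m2 hv' he' a b.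
Proof.
by rewrite (Prop_irrelevance hv hv') (Prop_irrelevance he he').
Qed.

Lemma approx_by_ext m1 m2 hv he a b a' b' :
  (forall v, a v = a' v) -> (forall f, b f = b' f) ->
  @approx_by B A m1 m2 hv he a b -> @approx_by B A m1 m2 hv he a' b'.
Proof.
move=> ea eb [h1 h2 h3]; split=> [f|v x|f].
- by rewrite -!eb.
- by rewrite -ea.
- by rewrite -ea -eb.
Qed.

Lemma approx_by_sym m1 m2 hv he a b :
  @approx_by B A m1 m2 hv he a b ->
  @approx_by B A m2 m1 (fun v => esym (hv v)) (fun f => esym (he f))
    (fun v => vgcast (hv v) (a v)^-1) (fun f => egcast (he f) (b f)^-1).
Proof.
case: m1 m2 hv he a b => [g1 v1 e1 t1 x1 y1] [g2 v2 e2 t2 x2 y2] hv he a b.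
have g : g1 = g2 by apply: gmor_eq.
subst g2 => -[/= h1 h2 h3]; split=> [f|v x|f] /=.
- by rewrite !egcast_id gmulfV h1.
- by rewrite h2 !vgcast_id -conjgM mulgV conjg1.
- by rewrite h3 !vgcast_id !egcast_id !gmulfV !invgM invgK -!mulgA.
Qed.

Lemma approx_by_trans m1 m2 m3 hv he a b hv' he' a' b' hv2 he2 :
  @approx_by B A m1 m2 hv he a b -> @approx_by B A m2 m3 hv' he' a' b' ->
  @approx_by B A m1 m3 hv2 he2
    (fun v => a v * vgcast (esym (hv v)) (a' v))
    (fun f => b f * egcast (esym (he f)) (b' f)).
Proof.
case: m1 m2 m3 hv he a b hv' he' a' b' hv2 he2 =>
  [g1 v1 e1 t1 x1 y1] [g2 v2 e2 t2 x2 y2] [g3 v3 e3 t3 x3 y3].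
move=> hv he a b hv' he' a' b' hv2 he2.
have g : g1 = g2 by apply: gmor_eq.
have g' : g2 = g3 by apply: gmor_eq.
subst g2 g3 => -[/= h1 h2 h3] [/= h1' h2' h3']; split=> [f|v x|f] /=.
- by rewrite !egcast_id gmulfM h1 h1'.
- by rewrite h2' h2 !vgcast_id conjgM.
- by rewrite h3 h3' !vgcast_id !egcast_id !gmulfM -!mulgA mulKg.
Qed.

(** The condition at the origin of f determines a_f from the value there, as
    alpha is injective; a_f is also the value on the inverse of f, so it gives
    back the value at the other end.  Connectedness propagates this to all of
    [B]. *)
Lemma approx_by_rigid m1 m2 hv he a b hv' he' a' b' v0 : connected B ->
  @approx_by B A m1 m2 hv he a b -> @approx_by B A m1 m2 hv' he' a' b' ->
  a v0 = a' v0 -> (forall v, a v = a' v) /\ (forall f, b f = b' f).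
Proof.
move=> cB [h1 _ h3] /(@approx_by_irr _ _ _ _ hv he) [h1' _ h3'] e0.
have he1 f : a (src f) = a' (src f) -> b f = b' f.
  by rewrite h3 h3' => /mulIg /mulgI /gmono_inj /gmono_inj.
have ha v : a v = a' v.
  elim: (cB v0 v) => // f _ /he1; rewrite -h1 -h1' => /gmono_inj ef.
  by rewrite /tgt h3 h3' ef.
by split=> // f; apply: he1.
Qed.

End Homotopies.

Lemma approx_by_compl C B A (n : mor B A) (m1 m2 : mor C B) hv he a b hv' he' :
  @approx_by C B m1 m2 hv he a b ->
  @approx_by C A (mor_comp n m1) (mor_comp n m2) hv' he'
    (fun v => mvg n _ (a v)) (fun f => meg n _ (b f)).
Proof.
case: m1 m2 hv he a b hv' he' => [g1 v1 e1 t1 x1 y1] [g2 v2 e2 t2 x2 y2].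
move=> hv he a b hv' he'; have g : g1 = g2 by apply: gmor_eq.
subst g2 => -[/= h1 h2 h3]; split=> [f|v x|f] /=.
- by rewrite emcast_comp h1.
- by rewrite h2 !vgcast_id gmulfJ.
- rewrite h3 !vgcast_id comp_alpha_edge !gmulfM !gmulfV /= invgM !mulgA.
  congr (_ * _); rewrite /conjg -!mulgA; congr (_ * _).
  by rewrite !mulVKg mulgV mulg1.
Qed.

(** Only vertex groups occur in the definition of the equivalence; on edge
    groups the conjugation formula follows because alpha is injective. *)
Lemma approx_by_edge B A (m1 m2 : mor B A) hv he a b :
  @approx_by B A m1 m2 hv he a b ->
  forall f x, meg m2 f x = egcast (he f) (meg m1 f x ^ b f).
Proof.
case: m1 m2 hv he a b => [g1 v1 e1 t1 x1 y1] [g2 v2 e2 t2 x2 y2] hv he a b.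
have g : g1 = g2 by apply: gmor_eq.
subst g2 => -[/= h1 h2 h3] f x; rewrite egcast_id.
apply/(gmono_inj (alpha _))/(gmono_inj (vgcast (src_me g1 f))).
rewrite x2 h2 !gmulfJ x1 h3 !vgcast_id -!conjgM.
by rewrite mulgVK.
Qed.

Definition gconj (G : groupType) (k : G) : gmono G G :=
  @gmono_of G G (fun x => x ^ k) (fun x y => conjMg x y k) (@conjg_inj G k).

Section Twist.
Context (B A : gog) (m : mor B A).
Context (a : forall v, vg A (mv m v)) (b : forall f, eg A (me m f)).
Context (b_einv : forall f, emcast m f (b (einv f)) = b f).

(** The morphism at the other end of a prescribed homotopy. *)
Definition twist : mor B A.
Proof.
refine (@mor_of B A m (fun v => gmono_comp (gconj (a v)) (mvg m v))
  (fun f => gmono_comp (gconj (b f)) (meg m f))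
  (fun f => (a (src f))^-1 *
            (twa m f * vgcast (src_me m f) (alpha (me m f) (b f)))) _ _).
- move=> f x; rewrite !gmono_compE /= !gmulfJ mor_alpha -!conjgM.
  by rewrite mulVKg.
- by move=> f x; rewrite !gmono_compE /= !gmulfJ meg_einv b_einv.
Defined.

Lemma twist_by : approx_by (m1 := m) (m2 := twist) (fun _ => erefl) (fun _ => erefl) a b.
Proof.
split=> //= f.
by rewrite invgM invgK !mulgA mulgV mul1g.
Qed.

End Twist.

(** * Choices compatible with edge inversion *)

(** One edge is picked from each pair {e, e^-1}: as the pair is a set, the same
    edge is picked from the side of e and from the side of e^-1. *)
Lemma orientation (X : graph) :
  exists O : edge X -> Prop, forall e, O (einv e) <-> ~ O e.
Proof.
have hS (e : edge X) : exists k, [set k | k = e \/ k = einv e] k by exists e; left.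
pose pick (S : set (edge X)) (hS : exists k, S k) := sval (cid hS).
pose k e := pick _ (hS e).
have hk e : k e = e \/ k e = einv e := svalP (cid (hS e)).
have kV e : k (einv e) = k e.
  rewrite /k; move: (hS (einv e)) (hS e).
  have -> : [set k | k = einv e \/ k = einv (einv e)] = [set k | k = e \/ k = einv e].
    by rewrite einvK eqEsubset; split=> y /= [->|->]; [right|left|right|left].
  by move=> p q; rewrite (Prop_irrelevance p q).
exists (fun e => k e = e) => e; rewrite kV; split=> [-> /einv_free //|ne].
by case: (hk e).
Qed.

(** Choose on the positively oriented edges and transport to their inverses. *)
Lemma einv_choice (X : graph) (T : edge X -> Type)
    (s : forall e, T (einv e) -> T e) (P : forall e, T e -> Prop) :
  (forall e (x : T (einv (einv e))), s e (s (einv e) x) = eq_rect _ T x e (einvK e)) ->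
  (forall e x, P (einv e) x -> P e (s e x)) -> (forall e, exists x, P e x) ->
  exists x : forall e, T e, (forall e, P e (x e)) /\ (forall e, s e (x (einv e)) = x e).
Proof.
move=> sK sP ex_x; have hx e := cid (ex_x e); have [O hO] := orientation X.
pose x e := if pselect (O e) then sval (hx e) else s e (sval (hx (einv e))).
exists x; split=> e; rewrite /x.
- by case: pselect => Oe; [|apply: sP]; apply: svalP.
- case: pselect => [OV|OV]; case: pselect => [Oe|Oe] //=.
  + by case/hO: OV.
  + rewrite sK.
    have hr y (p : y = e) : eq_rect y T (sval (hx y)) e p = sval (hx e) by subst y.
    exact: hr.
  + by case: OV; apply/hO.
Qed.

(** * Vertices and edges of the product *)

Lemma dcoset_eq (G H K : groupType) (m : gmono G K) (n : gmono H K) a x :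
  dcoset m n a x -> dcoset m n a = dcoset m n x.
Proof. by case=> b [d ->]; rewrite dcoset_mul. Qed.

Section Product.
Context (A B C : gog) (muB : mor B A) (muC : mor C A).

Lemma vX_rep (c : choices muB muC) x :
  vX x = dcoset (mvg muB (vB x)) (vright (vBC x)) (vrep c x).
Proof.
have [a ea] := vXP x; have := vrepP c x; rewrite ea; exact: dcoset_eq.
Qed.

Lemma eX_rep (c : choices muB muC) h :
  eX h = dcoset (meg muB (eB h)) (eright (eBC h)) (erep c h).
Proof.
have [a ea] := eXP h; have := erepP c h; rewrite ea; exact: dcoset_eq.
Qed.

(** Double cosets that meet are equal, so a vertex of the product is determined
    by its two projections and one element of its coset. *)
Lemma pvert_eq_mem (x y : pvert muB muC) a (p : vB x = vB y) (q : vC x = vC y) :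
  vX x a -> vX y (vgcast (f_equal (mv muB) p) a) -> x = y.
Proof.
case: x y a p q => v w r X hX [v' w' r' X' hX'] /= a p q; subst v' w'.
have e := Prop_irrelevance r r'; subst r'; rewrite vgcast_id => ha ha'.
have eX : X = X'.
  have [a0 e0] := hX; have [a1 e1] := hX'; move: ha ha'.
  by rewrite e0 e1 => /dcoset_eq -> /dcoset_eq ->.
by subst X'; rewrite (Prop_irrelevance hX hX').
Qed.

Lemma pedge_eq_mem (h k : pedge muB muC) a (p : eB h = eB k) (q : eC h = eC k) :
  eX h a -> eX k (egcast (f_equal (me muB) p) a) -> h = k.
Proof.
case: h k a p q => v w r X hX [v' w' r' X' hX'] /= a p q; subst v' w'.
have e := Prop_irrelevance r r'; subst r'; rewrite egcast_id => ha ha'.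
have eX : X = X'.
  have [a0 e0] := hX; have [a1 e1] := hX'; move: ha ha'.
  by rewrite e0 e1 => /dcoset_eq -> /dcoset_eq ->.
by subst X'; rewrite (Prop_irrelevance hX hX').
Qed.

Context (c : choices muB muC).

Lemma vrep_eq x y (e : x = y) (p : vg A (mv muB (vB x)) = vg A (mv muB (vB y))) :
  gcast p (vrep c x) = vrep c y.
Proof. by subst y; rewrite gcast_id. Qed.

Lemma erep_eq h k (e : h = k) (p : eg A (me muB (eB h)) = eg A (me muB (eB k))) :
  gcast p (erep c h) = erep c k.
Proof. by subst k; rewrite gcast_id. Qed.

(** The relation defining b_h and c_h, read over a vertex x that is only
    propositionally the origin of h; the transports r1, ..., r4 are arbitrary, so
    that the lemma applies whatever the shape of the equality proofs at hand. *)
Lemma twE_src h x (e : psrc h = x) (p : src (eB h) = vB x) (q : src (eC h) = vC x)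
    r1 r2 r3 r4 :
  vrep c x =
  mvg muB (vB x) (vgcast p (btw c h)) * vgcast r1 (twa muB (eB h)) *
    vgcast r2 (alpha (me muB (eB h)) (erep c h)) /
    (vgcast r3 (mvg muC (vC x) (vgcast q (ctw c h))) *
     vgcast r4 (twa muC (eC h))).
Proof.
subst x; rewrite !vgcast_id twE /porig /vright gmono_compE.
rewrite (vgcast_irr r2 (src_me muB (eB h))) (vgcast_irr r3 (esym (psrc_vw h))).
by rewrite (vgcast_irr r4 (esym (psrc_vw h))) invgM !mulgA.
Qed.

(** A twisting element (tB, tC) of the fibre of r may be inserted on both sides
    of a factorisation of r. *)
Lemma slide_conj (G : groupType) (tB tC b f a d g r : G) :
  r = b * f * a / (d * g) -> tB ^ r = tC -> r = tB * b * f * a / (tC * d * g).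
Proof.
move=> er <-.
have -> x : tB * b * f * a / (x * d * g) = tB * (b * f * a / (d * g)) / x.
  by rewrite !invgM !mulgA.
by rewrite -er [tB * r]conjgC mulgK.
Qed.

Section Canonical.
Context (Q : gog) (t : mor Q (aprod c)).

Lemma canonical_v v : mv muB (vB (mv t v)) = mv muC (vC (mv t v)).
Proof. exact: vBC. Qed.
Lemma canonical_e f : me muB (eB (me t f)) = me muC (eC (me t f)).
Proof. exact: eBC. Qed.

(** The chosen representatives form a homotopy between the two composites to
    [A].  The square is stated over an arbitrary t, and not for the projections
    alone, because (muB prB) t and muB (prB t) have the same underlying maps but
    are not the same term. *)
Lemma canonical_by :
  @approx_by Q A (mor_comp muB (mor_comp (prB c) t)) (mor_comp muC (mor_comp (prC c) t))
    canonical_v canonical_e (fun v => vrep c (mv t v)) (fun f => erep c (me t f)).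
Proof.
split=> [f|v x|f] /=.
- rewrite -(erep_inv c (me t f)).
  have <- := erep_eq (me_einv t f) (f_equal (fun h => eg A (me muB (eB h))) (me_einv t f)).
  rewrite /emcast gcast_comp; exact: gcast_irr.
- rewrite fib_rel /vright gmono_compE vgcast_comp.
  by rewrite vgcast_id.
- rewrite !gmulfM vgcast_comp; apply: slide_conj.
    apply: (twE_src (src_me t f)).
  rewrite fib_rel; exact: vgcast_irr.
Qed.
End Canonical.

End Product.

(** * The projections are jointly monic *)

Section JointlyMonic.
Context (A B C : gog) (muB : mor B A) (muC : mor C A) (c : choices muB muC).

Section Pair.
Context (Q : gog) (t t' : mor Q (aprod c)) (v0 : vert Q) (cQ : connected Q).
Let tB := mor_comp (prB c) t. Let tB' := mor_comp (prB c) t'.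
Let tC := mor_comp (prC c) t. Let tC' := mor_comp (prC c) t'.
Context (hvB : forall v, mv tB v = mv tB' v) (heB : forall f, me tB f = me tB' f).
Context (b : forall v, vg B (mv tB v)) (be : forall f, eg B (me tB f)).
Context (hvC : forall v, mv tC v = mv tC' v) (heC : forall f, me tC f = me tC' f).
Context (d : forall v, vg C (mv tC v)) (de : forall f, eg C (me tC f)).
Context (H1 : approx_by (m1 := tB) (m2 := tB') hvB heB b be).
Context (H2 : approx_by (m1 := tC) (m2 := tC') hvC heC d de).
Context (e0 : mv t v0 = mv t' v0).
Context (b0 : b v0 = 1).
Context (d0 : d v0 = 1).

(** Two homotopies from muB prB t to muC prC t': along the canonical one of t and
    then d, or along b and then the canonical one of t'. *)
Lemma rep_transport :
  (forall v, vrep c (mv t v) * vright (vBC (mv t v)) (d v) =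
     mvg muB _ (b v) * vgcast (esym (f_equal (mv muB) (hvB v))) (vrep c (mv t' v))) /\
  (forall f, erep c (me t f) * eright (eBC (me t f)) (de f) =
     meg muB _ (be f) * egcast (esym (f_equal (me muB) (heB f))) (erep c (me t' f))).
Proof.
have hv v : mv (mor_comp muB (mor_comp (prB c) t)) v =
   mv (mor_comp muC (mor_comp (prC c) t')) v.
  exact: etrans (vBC (mv t v)) (f_equal (mv muC) (hvC v)).
have he f : me (mor_comp muB (mor_comp (prB c) t)) f =
   me (mor_comp muC (mor_comp (prC c) t')) f.
  exact: etrans (eBC (me t f)) (f_equal (me muC) (heC f)).
have K1 := approx_by_trans hv he (canonical_by t)
  (approx_by_compl (n := muC) (fun v => f_equal (mv muC) (hvC v))
    (fun f => f_equal (me muC) (heC f)) H2).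
have K2 := approx_by_trans hv he
  (approx_by_compl (n := muB) (fun v => f_equal (mv muB) (hvB v))
    (fun f => f_equal (me muB) (heB f)) H1)
  (canonical_by t').
have [] := approx_by_rigid (v0 := v0) cQ K1 K2.
  rewrite b0 d0 !gmulf1 mulg1 mul1g; symmetry; exact: vrep_eq.
move=> kv ke; split=> [v|f].
- by move: (kv v); rewrite /vright gmono_compE => <-; congr (_ * _); apply: vgcast_irr.
- by move: (ke f); rewrite /eright gmono_compE => <-; congr (_ * _); apply: gcast_irr.
Qed.

(** By [rep_transport] the coset of t(v) contains an element of the coset of
    t'(v). *)
Lemma gmor_transport : mgr t = mgr t'.
Proof.
have [kv ke] := rep_transport.
apply: gmor_eq => [v|f].
- apply: (@pvert_eq_mem _ _ _ _ _ _ _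
    (mvg muB _ (b v)^-1 * vrep c (mv t v) * vright (vBC (mv t v)) (d v))
    (hvB v) (hvC v)).
    by rewrite (vX_rep c); exists (b v)^-1, (d v).
  rewrite -[_ * _ * vright _ _]mulgA kv gmulfV mulKg vgcastK; exact: vrepP.
- apply: (@pedge_eq_mem _ _ _ _ _ _ _
    (meg muB _ (be f)^-1 * erep c (me t f) * eright (eBC (me t f)) (de f))
    (heB f) (heC f)).
    by rewrite (eX_rep c); exists (be f)^-1, (de f).
  rewrite -[_ * _ * eright _ _]mulgA ke gmulfV mulKg /egcast gcast_comp gcast_id.
  exact: erepP.
Qed.

End Pair.

Lemma proj_jointly_monic (Q : gog) (t t' : mor Q (aprod c)) v0 : connected Q ->
  mv t v0 = mv t' v0 ->
  approx_at v0 (mor_comp (prB c) t) (mor_comp (prB c) t') ->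
  approx_at v0 (mor_comp (prC c) t) (mor_comp (prC c) t') ->
  approx_at v0 t t'.
Proof.
move=> cQ e0 [hvB [heB [b [be [H1 b0]]]]] [hvC [heC [d [de [H2 d0]]]]].
have g := gmor_transport cQ H1 H2 e0 b0 d0.
have [kv ke] := rep_transport cQ H1 H2 e0 b0 d0.
case: t t' g hvB heB b be H1 b0 hvC heC d de H2 d0 kv ke {e0} =>
  [g1 v1 e1 t1 x1 y1] [g2 v2 e2 t2 x2 y2] /= g; subst g2.
move=> hvB heB b be [/= b1 b2 b3] b0 hvC heC d de [/= d1 d2 d3] d0 kv ke.
(* [rep_transport] now says that (b, d) lies in the groups of the product. *)
have relv v : mvg muB (vB (mv g1 v)) (b v) ^ vrep c (mv g1 v) =
    vright (vBC (mv g1 v)) (d v).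
  by move: (kv v); rewrite vgcast_id /conjg => <-; rewrite mulKg.
have rele f : meg muB (eB (me g1 f)) (be f) ^ erep c (me g1 f) =
    eright (eBC (me g1 f)) (de f).
  by move: (ke f); rewrite egcast_id /conjg => <-; rewrite mulKg.
apply/approx_byP; exists erefl, (fun v => fib_mk (relv v)), (fun f => fib_mk (rele f)).
split; last by apply: fib_inj1; rewrite /= b0.
(* An element of a fibre is determined by its coordinate in [B], so what is left
   is the homotopy b from prB t to prB t'. *)
split=> [f|v x|f] /=.
- apply: (gmono_inj (meg (prB c) _)).
  by rewrite -emcast_comp /= b1.
- by apply: fib_inj1; rewrite /= b2 vgcast_id.
- apply: (gmono_inj (mvg (prB c) _)); rewrite !gmulfM gmulfV.
  rewrite (mvg_vgcast (m := prB c) _ (f_equal (@vB _ _ _ _ _) (src_me g1 f))) /=.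
  rewrite b3 !vgcast_id !gmulfM gmulfV !invgM !invgK -!mulgA.
  rewrite (vgcast_irr (etrans _ _) (f_equal (@vB _ _ _ _ _) (src_me g1 f))).
  by rewrite !mulKg /= mulgV mulg1.
Qed.

End JointlyMonic.

(** * Lifting a normalised pair of morphisms *)

(** Two factorisations of r with the same middle term differ by an element of
    the fibre of r. *)
Lemma quot_conj (G : groupType) (tB tC b f a d g r : G) :
  r = tB * f * a / (tC * g) -> r = b * f * a / (d * g) -> (tB / b) ^ r = tC / d.
Proof.
move=> e1 e2; apply: (mulgI r); rewrite -conjgC {1}e2 e1 !invgM !mulgA.
by rewrite !mulgVK.
Qed.

(** The cosets [X], [Y] are data of their own, not the cosets spanned by the
    homotopy: they will come from a homotopy before its values are replaced by
    the representatives.  The vertices x and edges y project to those of sB and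
    sC by conversion. *)
Section Lift.
Context (A B C : gog) (muB : mor B A) (muC : mor C A) (c : choices muB muC).
Context (Q : gog) (sB : mor Q B) (sC : mor Q C).
Context (hv : forall v, mv muB (mv sB v) = mv muC (mv sC v)).
Context (he : forall f, me muB (me sB f) = me muC (me sC f)).
Context (X : forall v, set (vg A (mv muB (mv sB v)))).
Context (Y : forall f, set (eg A (me muB (me sB f)))).
Arguments X : clear implicits.
Arguments Y : clear implicits.
Context (XP : forall v, exists a, X v = dcoset (mvg muB _) (vright (hv v)) a).
Context (YP : forall f, exists a, Y f = dcoset (meg muB _) (eright (he f)) a).
Let x v := PVert (XP v).
Let y f := PEdge (YP f).
Context (y_src : forall f, psrc (y f) = x (src f)).
Context (y_einv : forall f, y (einv f) = pinv (y f)).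

Definition lift_gmor : gmor Q (aprod c) := @Gmor Q (aprod c) x y y_src y_einv.

Context (H : @approx_by Q A (mor_comp muB sB) (mor_comp muC sC) hv he
  (fun v => vrep c (x v)) (fun f => erep c (y f))).

(** As the homotopy consists of the representatives, its conjugation formula is
    the equation of the fibre. *)
Lemma lift_vP v z : mvg muB _ (mvg sB v z) ^ vrep c (x v) = vright (hv v) (mvg sC v z).
Proof.
have [_ h _] := H; rewrite /vright gmono_compE.
have /= -> := h v z; by rewrite vgcastK.
Qed.

Lemma lift_eP f z : meg muB _ (meg sB f z) ^ erep c (y f) = eright (he f) (meg sC f z).
Proof.
have /= h := approx_by_edge H; rewrite /eright /= h.
by rewrite /egcast gcast_comp gcast_id.
Qed.

Let pB f : src (me sB f) = mv sB (src f) := src_me sB f.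
Let pC f : src (me sC f) = mv sC (src f) := src_me sC f.

(** Dividing by b_h and c_h makes the composites with the projections have the
    twisting elements of sB and sC.  The quotients form an element of the fibre
    because the homotopy condition and the choice of b_h, c_h are two
    factorisations of the representative at the origin of f. *)
Lemma lift_twP f :
  mvg muB _ (twa sB f / vgcast (pB f) (btw c (y f))) ^ vrep c (x (src f)) =
  vright (hv (src f)) (twa sC f / vgcast (pC f) (ctw c (y f))).
Proof.
have [_ _ /(_ f) h] := H; rewrite !gmulfF.
move: h => /=; rewrite !gmulfM vgcast_comp => h.
apply: quot_conj h _.
refine (@twE_src A B C muB muC c (y f) (x (src f)) (y_src f)
  (src_me sB f) (src_me sC f) _ _ _ _).
Qed.

Definition lift_v v : gmono (vg Q v) (pvg c (x v)).
Proof.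
refine (@gmono_of _ (pvg c (x v)) (fun z => fib_mk (lift_vP z)) _ _).
- by move=> z w; apply: fib_inj1; rewrite /= gmulfM.
- by move=> z w /(f_equal fib1) /= /gmono_inj.
Defined.

Definition lift_e f : gmono (eg Q f) (peg c (y f)).
Proof.
refine (@gmono_of _ (peg c (y f)) (fun z => fib_mk (lift_eP z)) _ _).
- by move=> z w; apply: fib_inj1; rewrite /= gmulfM.
- by move=> z w /(f_equal fib1) /= /gmono_inj.
Defined.

Definition lift : mor Q (aprod c).
Proof.
refine (@mor_of Q (aprod c) lift_gmor lift_v lift_e
  (fun f => fib_mk (lift_twP f)) _ _) => f z.
(* The coordinate in [B] determines an element of a fibre, so both squares may
   be checked after composing with [prB]. *)
- apply: (gmono_inj (mvg (prB c) _)); rewrite gmulfJ.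
  rewrite (@mvg_vgcast _ _ (prB c) (psrc (y f)) (x (src f)) _ (pB f)) /=.
  rewrite !gmulfM gmulfV mor_alpha.
  by rewrite conjgM [in RHS]/conjg invgK !mulgA.
- apply: (gmono_inj (meg (prB c) _)); rewrite -emcast_comp /= meg_einv.
  exact: gcast_irr.
Defined.

Lemma prB_lift v0 : approx_at v0 (mor_comp (prB c) lift) sB.
Proof.
have g : mgr (mor_comp (prB c) lift) = mgr sB by apply: gmor_eq.
apply: (@approx_eq _ _ _ _ _ g) => [v z|f]; rewrite vgcast_id //=.
by rewrite (vgcast_irr _ (pB f)) mulgVK.
Qed.

Lemma prC_lift v0 : approx_at v0 (mor_comp (prC c) lift) sC.
Proof.
have g : mgr (mor_comp (prC c) lift) = mgr sC by apply: gmor_eq.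
apply: (@approx_eq _ _ _ _ _ g) => [v z|f]; rewrite vgcast_id //=.
by rewrite (vgcast_irr _ (pC f)) mulgVK.
Qed.

End Lift.

(** * The morphism induced by a homotopy *)

Section Induced.
Context (A B C : gog) (muB : mor B A) (muC : mor C A) (c : choices muB muC).
Context (Q : gog) (sB : mor Q B) (sC : mor Q C).
Context (hv : forall v, mv muB (mv sB v) = mv muC (mv sC v)).
Context (he : forall f, me muB (me sB f) = me muC (me sC f)).
Context (a : forall v, vg A (mv muB (mv sB v))).
Context (b : forall f, eg A (me muB (me sB f))).
Context (H : @approx_by Q A (mor_comp muB sB) (mor_comp muC sC) hv he a b).

Definition induced_v v : pvert muB muC :=
  PVert (ex_intro _ (a v) (erefl (dcoset (mvg muB _) (vright (hv v)) (a v)))).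

Definition induced_e f : pedge muB muC :=
  PEdge (ex_intro _ (b f) (erefl (dcoset (meg muB _) (eright (he f)) (b f)))).

Lemma induced_src f : psrc (induced_e f) = induced_v (src f).
Proof.
apply: (@pvert_eq_mem _ _ _ _ _ (psrc (induced_e f)) (induced_v (src f))
  (porig (induced_e f) (b f)) (src_me sB f) (src_me sC f)).
  by exists (b f); apply: dcoset_refl.
have [_ _ /(_ f) /= h] := H.
exists (twa sB f)^-1, (twa sC f); rewrite h /porig /vright /= !gmulfM !gmulfV.
rewrite !vgcast_comp invgM !mulgA mulVg mul1g mulgVK.
by congr (_ * _ / _); apply: vgcast_irr.
Qed.

Lemma induced_einv f : induced_e (einv f) = pinv (induced_e f).
Proof.
apply: (@pedge_eq_mem _ _ _ _ _ (induced_e (einv f)) (pinv (induced_e f))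
  (b (einv f)) (me_einv sB f) (me_einv sC f)).
  exact: dcoset_refl.
have [h _ _] := H; rewrite /= /pinv_set /=.
have -> : emcast muB (me sB f) (egcast (f_equal (me muB) (me_einv sB f)) (b (einv f))) = b f.
  by rewrite -[RHS]h /emcast /egcast gcast_comp; apply: gcast_irr.
exact: dcoset_refl.
Qed.

Lemma induced_erep_einv f :
  emcast (gmor_comp muB sB) f (erep c (induced_e (einv f))) = erep c (induced_e f).
Proof.
rewrite -(erep_inv c (induced_e f)).
have <- := erep_eq c (induced_einv f) (f_equal (eg A) (f_equal (me muB) (me_einv sB f))).
by rewrite /emcast gcast_comp; apply: gcast_irr.
Qed.

Lemma eright_emcast f z :
  eright (he f) (emcast sC f z) = emcast (gmor_comp muB sB) f (eright (he (einv f)) z).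
Proof.
rewrite /eright /= -emcast_comp /emcast /egcast !gcast_comp; exact: gcast_irr.
Qed.

(** Where the homotopy already takes the chosen representative, the correction
    can be taken trivial: this keeps the base vertex fixed. *)
Lemma vertex_adjust v0 : vrep c (induced_v v0) = a v0 ->
  exists p q, [/\ forall v,
    vrep c (induced_v v) = (mvg muB _ (p v))^-1 * a v * vright (hv v) (q v),
    p v0 = 1 & q v0 = 1].
Proof.
move=> e0.
have hx v : exists pq, vrep c (induced_v v) =
    (mvg muB _ pq.1)^-1 * a v * vright (hv v) pq.2 /\ (v = v0 -> pq = (1, 1)).
  have [->|ne] := EM (v = v0).
    by exists (1, 1); rewrite e0 !gmulf1 invg1 mul1g mulg1.
  have [p [q e]] := vrepP c (induced_v v).
  by exists (p^-1, q); rewrite -gmulfV invgK.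
have hx' v := cid (hx v).
exists (fun v => (sval (hx' v)).1), (fun v => (sval (hx' v)).2).
split=> [v||]; first by case: (hx' v) => -[p q] [].
- by case: (hx' v0) => -[p q] /= [_ /(_ erefl) []].
- by case: (hx' v0) => -[p q] /= [_ /(_ erefl) []].
Qed.

(** The corrections are not unique, hence the choice on both f and f^-1 at
    once. *)
Lemma edge_adjust :
  exists p q, [/\ forall f,
    erep c (induced_e f) = (meg muB _ (p f))^-1 * b f * eright (he f) (q f),
    forall f, emcast sB f (p (einv f)) = p f &
    forall f, emcast sC f (q (einv f)) = q f].
Proof.
have [hb _ _] := H.
pose T f := (eg B (me sB f) * eg C (me sC f))%type.
pose s f (z : T (einv f)) : T f := (emcast sB f z.1, emcast sC f z.2).
pose P f (z : T f) := erep c (induced_e f) =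
  (meg muB _ z.1)^-1 * b f * eright (he f) z.2.
have [||f|pq [h1 h2]] := @einv_choice Q T s P.
- move=> f z.
  have -> f' (e : f' = f) (y : T f') : eq_rect f' T y f e =
     (egcast (f_equal (me sB) e) y.1, egcast (f_equal (me sC) e) y.2).
    by subst f'; rewrite !egcast_id; case: y.
  by rewrite /s /emcast /egcast !gcast_comp; congr pair; apply: gcast_irr.
- move=> f z; rewrite /P => h; rewrite -induced_erep_einv h !gmulfM gmulfV /=.
  rewrite emcast_comp; congr (_ * _ * _); first exact: hb.
  by symmetry; apply: eright_emcast.
- have [p [q e]] := erepP c (induced_e f).
  by exists (p^-1, q); rewrite /P -gmulfV invgK.
exists (fun f => (pq f).1), (fun f => (pq f).2).
by split=> [f|f|f]; [apply: h1| |]; rewrite -[in RHS]h2.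
Qed.

Lemma induced_mor v0 : vrep c (induced_v v0) = a v0 ->
  exists t : mor Q (aprod c), [/\ mv t v0 = induced_v v0,
    approx_at v0 (mor_comp (prB c) t) sB & approx_at v0 (mor_comp (prC c) t) sC].
Proof.
move=> /vertex_adjust [p [q [hpq p0 q0]]].
have [pe [qe [hpqe pV qV]]] := edge_adjust.
(* Conjugating sB by p and sC by q turns the given homotopy into the family of
   chosen representatives and leaves the underlying graph morphisms alone. *)
pose tB := twist p pV; pose tC := twist q qV.
have TB := twist_by p pV; have TC := twist_by q qV.
have H' : @approx_by Q A (mor_comp muB tB) (mor_comp muC tC) hv he
    (fun v => vrep c (induced_v v)) (fun f => erep c (induced_e f)).
  have S := approx_by_sym (approx_by_compl (n := muB) (m1 := sB) (m2 := tB)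
    (fun _ => erefl) (fun _ => erefl) TB).
  have S2 := approx_by_compl (n := muC) (m1 := sC) (m2 := tC)
    (fun _ => erefl) (fun _ => erefl) TC.
  have S1 := approx_by_trans (m1 := mor_comp muB tB) (m3 := mor_comp muC sC) hv he S H.
  have S3 := approx_by_trans (m1 := mor_comp muB tB) (m3 := mor_comp muC tC) hv he S1 S2.
  apply: approx_by_ext S3 => [v|f] /=.
  - by rewrite hpq.
  - by rewrite hpqe.
exists (lift (sB := tB) (sC := tC) induced_src induced_einv H'); split=> //.
- apply: approx_trans
    (prB_lift (sB := tB) (sC := tC) induced_src induced_einv H' v0) _.
  apply: approx_sym.
  by exists (fun _ => erefl), (fun _ => erefl), p, pe.
- apply: approx_trans
    (prC_lift (sB := tB) (sC := tC) induced_src induced_einv H' v0) _.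
  apply: approx_sym.
  by exists (fun _ => erefl), (fun _ => erefl), q, qe.
Qed.

End Induced.

(** * Connected components *)

Section IntoComponent.
Context (A : gog) (u0 : vert A) (Q : gog).

(** On groups the inclusion is the identity, so a homotopy after it is a homotopy
    before it. *)
Lemma incl_monic v0 (m n : mor Q (component u0)) :
  approx_at v0 (mor_comp (incl u0) m) (mor_comp (incl u0) n) -> approx_at v0 m n.
Proof.
case=> hv [he [a [b [h a0]]]].
have g : mgr m = mgr n.
  have sval_inj T (P : T -> Prop) (x y : {x | P x}) : sval x = sval y -> x = y.
    by case: x y => x px [y py]; apply: eq_exist.
  by apply: gmor_eq => [v|f]; apply: sval_inj; [apply: hv|apply: he].
case: m n g hv he a b h a0 => [g1 v1 e1 t1 x1 y1] [g2 v2 e2 t2 x2 y2] /= g; subst g2.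
move=> hv he a b [/= h1 h2 h3] a0.
apply/approx_byP; exists erefl, a, b; split=> //; split=> [f|v x|f] /=.
- apply: (gmono_inj (meg (incl u0) _)); rewrite -emcast_comp; exact: h1.
- by rewrite h2 vgcast_id.
- apply: (gmono_inj (mvg (incl u0) _)); rewrite !gmulfM gmulfV.
  rewrite (@mvg_vgcast _ _ (incl u0) _ _ _ (f_equal sval (src_me g1 f))) /=.
  rewrite h3 !vgcast_id !gmulf1 !mulg1.
  rewrite (vgcast_irr (etrans _ _) (f_equal sval (src_me g1 f))).
  by rewrite !invgM !invgK -!mulgA !mulKg mulVg mulg1.
Qed.

Lemma reach_mv (X Y : graph) (m : gmor X Y) u v : reach u v -> reach (mv m u) (mv m v).
Proof.
elim=> [|e _ ih]; first exact: reach_refl.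
rewrite -tgt_me; apply: reach_step; by rewrite src_me.
Qed.

Context (v0 : vert Q) (t : mor Q A) (ct : forall v, reach u0 (mv t v)).

Definition corestr_gmor : gmor Q (component u0).
Proof.
refine (@Gmor Q (component u0) (fun v => exist _ (mv t v) (ct v))
  (fun f => exist _ (me t f) (eq_ind_r (reach u0) (ct (src f)) (src_me t f))) _ _).
- by move=> f; apply: eq_exist; apply: src_me.
- by move=> f; apply: eq_exist; apply: me_einv.
Defined.

Definition corestr : mor Q (component u0).
Proof.
refine (@mor_of Q (component u0) corestr_gmor (mvg t) (meg t) (twa t) _ _) => f x.
- apply: (gmono_inj (mvg (incl u0) _)).
  rewrite (@mvg_vgcast _ _ (incl u0) (src (me corestr_gmor f))
    (mv corestr_gmor (src f)) _ (src_me t f)) /=.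
  exact: mor_alpha.
- apply: (gmono_inj (meg (incl u0) _)); rewrite -emcast_comp /= meg_einv.
  exact: gcast_irr.
Defined.

Lemma incl_corestr : approx_at v0 (mor_comp (incl u0) corestr) t.
Proof.
have g : mgr (mor_comp (incl u0) corestr) = mgr t by apply: gmor_eq.
apply: (@approx_eq _ _ _ _ _ g) => [v z|f]; rewrite vgcast_id //=.
by rewrite gmulf1 mulg1.
Qed.
End IntoComponent.

(** * The pullback *)

Section Pointed.
Context (A B C : pgog) (muB : pmor B A) (muC : pmor C A) (c : pchoices muB muC).

Lemma rho_comm : sim (pmor_comp muB (rhoB c)) (pmor_comp muC (rhoC c)).
Proof.
have h := @canonical_by _ _ _ muB muC c _ (@incl (aprod c) (pbase muB muC)).
by eexists _, _, _, _; split; [exact: h | exact: (pc_base c)].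
Qed.

Lemma rho_jointly_monic (Q : pgog) (t t' : pmor Q (pprod c)) :
  sim (pmor_comp (rhoB c) t) (pmor_comp (rhoB c) t') ->
  sim (pmor_comp (rhoC c) t) (pmor_comp (rhoC c) t') -> sim t t'.
Proof.
move=> hB hC; apply: incl_monic.
apply: (proj_jointly_monic (@pg_connected Q)).
- exact: (f_equal sval (etrans (pm_pt t) (esym (pm_pt t')))).
- apply: approx_trans (mor_compA _ _ _ _) _.
  exact: approx_trans hB (approx_sym (mor_compA _ _ _ _)).
- apply: approx_trans (mor_compA _ _ _ _) _.
  exact: approx_trans hC (approx_sym (mor_compA _ _ _ _)).
Qed.

Lemma rho_factor (Q : pgog) (sB : pmor Q B) (sC : pmor Q C) :
  sim (pmor_comp muB sB) (pmor_comp muC sC) ->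
  exists t : pmor Q (pprod c),
    sim (pmor_comp (rhoB c) t) sB /\ sim (pmor_comp (rhoC c) t) sC.
Proof.
case=> hv [he [a [b [H a1]]]].
have base : pbase muB muC = induced_v hv a (pt Q).
  apply: (@pvert_eq_mem _ _ _ _ _ (pbase muB muC) (induced_v hv a (pt Q)) 1
    (esym (pm_pt sB)) (esym (pm_pt sC))); first exact: dcoset_refl.
  by rewrite gmulf1 -a1; apply: dcoset_refl.
have ra : vrep c (induced_v hv a (pt Q)) = a (pt Q).
  rewrite a1 -(vrep_eq c base (f_equal (vg A) (f_equal (mv muB) (esym (pm_pt sB))))).
  by rewrite pc_base gmulf1.
have [t [t0 tB tC]] := induced_mor H ra.
have rt v : @reach (aprod c) (pbase muB muC) (mv t v).
  by rewrite base -t0; apply: reach_mv; apply: pg_connected.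
have t'0 : mv (corestr rt) (pt Q) = pt (pprod c).
  by apply: eq_exist; rewrite t0 base.
have it := incl_corestr (pt Q) rt.
exists (@Pmor Q (pprod c) (corestr rt) t'0); split.
- apply: approx_trans tB.
  apply: approx_trans (approx_sym (mor_compA _ _ _ _)) _; exact: approx_compl.
- apply: approx_trans tC.
  apply: approx_trans (approx_sym (mor_compA _ _ _ _)) _; exact: approx_compl.
Qed.

Lemma pprod_pullback : @is_pullback GrGp_pt A B C (pprod c)
  (cls muB) (cls muC) (cls (rhoB c)) (cls (rhoC c)).
Proof.
split; first by rewrite /= !arrow_comp_cls; apply/cls_eq/rho_comm.
move=> Q x y /=; have [sB ->] := arrowP x; have [sC ->] := arrowP y.
rewrite !arrow_comp_cls => /cls_eq /rho_factor [t [tB tC]].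
exists (cls t); split=> [|z].
  by rewrite !arrow_comp_cls; split; apply/cls_eq.
have [t' ->] := arrowP z; rewrite !arrow_comp_cls => -[/cls_eq hB /cls_eq hC].
apply/cls_eq/rho_jointly_monic.
- exact: approx_trans tB (approx_sym hB).
- exact: approx_trans tC (approx_sym hC).
Qed.

End Pointed.

Theorem theoremA :
  (forall (A B C : GrGp_pt) (f : hom B A) (g : hom C A),
     exists (P : GrGp_pt) (r : hom P B) (s : hom P C), is_pullback f g r s) /\
  (forall (A B C : pgog) (muB : pmor B A) (muC : pmor C A)
          (c : pchoices muB muC),
     @is_pullback GrGp_pt A B C (pprod c)
       (cls muB) (cls muC) (cls (rhoB c)) (cls (rhoC c))).
Proof.
split=> A B C; last exact: pprod_pullback.
move=> f g; have [muB ->] := arrowP f; have [muC ->] := arrowP g.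
have [c] := pchoices_exist muB muC.
exists (pprod c), (cls (rhoB c)), (cls (rhoC c)); exact: pprod_pullback.
Qed.
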